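(* Let $\Lambda=\{1,\ldots,N_s\}$ with $N_s$ even and periodic boundary conditions, $t>0$, $t'>0$, and $$H=-t\sum_{x=1}^{N_s}\sum_{\sigma}(c^\dagger_{x,\sigma}c_{x+1,\sigma}+c^\dagger_{x+1,\sigma}c_{x,\sigma})+t'\sum_{j=1}^{N_s/2}\sum_{\sigma}(c^\dagger_{2j,\sigma}c_{2j+2,\sigma}+c^\dagger_{2j+2,\sigma}c_{2j,\sigma})+U\sum_{x}n_{x,\uparrow}n_{x,\downarrow}+V\Big\{\sum_{x=1}^{N_s}n_xn_{x+1}-(2N_e-N_s)\Big\}.$$ Let the electron number $N_e$ be odd with $N_s>N_e>N_s/2$, and take the limits $U\to\infty$, $V\to\infty$. Then the ground states have total spin $S_{\rm tot}=S_{\max}=N_e/2$ and are nondegenerate apart from the trivial $(2S_{\max}+1)$-fold degeneracy.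
   Context: $c_{x,\sigma}$ are fermion annihilation operators ($x\in\Lambda$, $\sigma\in\{\uparrow,\downarrow\}$) with canonical anticommutation relations and vacuum $\Phi_{\rm vac}$; $\mathcal H_{N_e}$ is the span of $c^\dagger_{x_1,\sigma_1}\cdots c^\dagger_{x_{N_e},\sigma_{N_e}}\Phi_{\rm vac}$; $n_{x,\sigma}=c^\dagger_{x,\sigma}c_{x,\sigma}$, $n_x=n_{x,\uparrow}+n_{x,\downarrow}$. The limit $U,V\to\infty$ means: let $P$ be the orthogonal projection onto the span of states with no doubly occupied site and with $\sum_x n_xn_{x+1}=2N_e-N_s$ (its minimal possible value, equivalently no two neighboring empty sites); one studies $PH_{\rm hop}P$ on $P\mathcal H_{N_e}$, where $H_{\rm hop}$ consists of the $t$ and $t'$ terms of $H$; ground states are its lowest-eigenvalue eigenvectors. Total spin operators $S^{(\alpha)}_{\rm tot}=\frac12\sum_x\sum_{\sigma,\tau}c^\dagger_{x,\sigma}(p^{(\alpha)})_{\sigma,\tau}c_{x,\tau}$ (Pauli matrices); total spin $S_{\rm tot}$ means $\sum_\alpha(S^{(\alpha)}_{\rm tot})^2=S_{\rm tot}(S_{\rm tot}+1)$. ''Nondegenerate apart from the trivial $(2S_{\max}+1)$-fold degeneracy'' means the ground-state eigenspace has dimension exactly $2S_{\max}+1$ and all ground states have $S_{\rm tot}=S_{\max}$. *)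

(* Defs.v *)
(* Fermionic Fock space of N_s sites x 2 spins, realized
   concretely on the basis of occupation sets {set 'I_Ns * bool}. *)
From HB Require Import structures.
From mathcomp Require Import all_boot all_order all_algebra.
Set Implicit Arguments. Unset Strict Implicit. Unset Printing Implicit Defensive.
Import Order.TTheory GRing.Theory Num.Theory.
Local Open Scope ring_scope.

(* A mode is (site, spin); spin true = up, false = down.  Site x : 'I_Ns is
   the paper's site x+1. *)
Notation mode Ns := ('I_Ns * bool)%type.
(* Fock basis states: sets of occupied modes. *)
Notation fock Ns := {set mode Ns}.
Notation dimF Ns := #|{: {set mode Ns}}|.

Section Fock.
Variable C : numClosedFieldType.
Variable Ns : nat.

(* fixed total order on modes used for the Jordan-Wigner signs *)
Definition midx (m : mode Ns) : nat := (2 * m.1 + m.2)%N.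

Definition jwsign (T : fock Ns) (m : mode Ns) : C :=
  (-1) ^+ #|[set m' in T | (midx m' < midx m)%N]|.

Definition opmx (f : fock Ns -> fock Ns -> C) : 'M[C]_(dimF Ns) :=
  \matrix_(i, j) f (enum_val i) (enum_val j).

Definition cann (m : mode Ns) : 'M[C]_(dimF Ns) :=
  opmx (fun S T => if (m \in T) && (S == T :\ m) then jwsign T m else 0).

(* creation operator c^dagger_m: the adjoint of c_m (entries are real) *)
Definition ccre (m : mode Ns) : 'M[C]_(dimF Ns) :=
  opmx (fun S T => if (m \notin T) && (S == m |: T) then jwsign T m else 0).

(* c_{k,s} for a 0-based site label k taken modulo Ns (periodic b.c.) *)
Definition cann_at (k : nat) (s : bool) : 'M[C]_(dimF Ns) :=
  \sum_(x : 'I_Ns | val x == (k %% Ns)%N) cann (x, s).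
Definition ccre_at (k : nat) (s : bool) : 'M[C]_(dimF Ns) :=
  \sum_(x : 'I_Ns | val x == (k %% Ns)%N) ccre (x, s).

Definition bond (a b : nat) : 'M[C]_(dimF Ns) :=
  \sum_(s : bool) (ccre_at a s *m cann_at b s + ccre_at b s *m cann_at a s).

(* H_hop : the t and t' terms of H.  Paper's x in 1..Ns is 0-based x-1;
   paper's sites 2j, 2j+2 (j = 1..Ns/2) are 0-based 2j-1, 2j+1, i.e. for
   j' = j-1 in 0..Ns/2-1 they are 2j'+1, 2j'+3. *)
Definition Hhop (t t' : C) : 'M[C]_(dimF Ns) :=
  - t *: (\sum_(x < Ns) bond x x.+1)
  + t' *: (\sum_(j < Ns./2) bond (2 * j).+1 (2 * j).+3).

Definition nocc (S : fock Ns) (x : 'I_Ns) : nat :=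
  ((x, true) \in S) + ((x, false) \in S).

Definition nxt (x : 'I_Ns) : 'I_Ns :=
  Ordinal (ltn_pmod x.+1 (leq_ltn_trans (leq0n x) (ltn_ord x))).

Definition allowed (Ne : nat) (S : fock Ns) : bool :=
  [&& #|S| == Ne,
      [forall x : 'I_Ns, ~~ (((x, true) \in S) && ((x, false) \in S))] &
      (\sum_(x : 'I_Ns) nocc S x * nocc S (nxt x))%N == (2 * Ne - Ns)%N].

Definition Pproj (Ne : nat) : 'M[C]_(dimF Ns) :=
  opmx (fun S T => if (S == T) && allowed Ne T then 1 else 0).

Definition Heff (Ne : nat) (t t' : C) : 'M[C]_(dimF Ns) :=
  Pproj Ne *m Hhop t t' *m Pproj Ne.

Definition is_eigval (Ne : nat) (t t' : C) (E : C) : Prop :=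
  exists v : 'cV[C]_(dimF Ns),
    [/\ v != 0, Pproj Ne *m v = v & Heff Ne t t' *m v = E *: v].

Definition is_ground_energy (Ne : nat) (t t' : C) (E : C) : Prop :=
  is_eigval Ne t t' E /\ forall l, is_eigval Ne t t' l -> E <= l.

Definition ground_state (Ne : nat) (t t' : C) (E : C) (v : 'cV[C]_(dimF Ns))
  : Prop :=
  Pproj Ne *m v = v /\ Heff Ne t t' *m v = E *: v.

(* Pauli matrices p^(a), a = 0,1,2 for x,y,z; index true = up, false = down *)
Definition pauli (a : 'I_3) (s u : bool) : C :=
  match val a with
  | 0%N => if s != u then 1 else 0
  | 1%N => if s == u then 0 else if s then - 'i else 'i
  | _ => if s == u then (if s then 1 else -1) else 0
  end.

Definition Stot (a : 'I_3) : 'M[C]_(dimF Ns) :=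
  2%:R^-1 *: \sum_(x : 'I_Ns) \sum_(s : bool) \sum_(u : bool)
     pauli a s u *: (ccre (x, s) *m cann (x, u)).

Definition Ssq : 'M[C]_(dimF Ns) := \sum_(a < 3) Stot a *m Stot a.

Definition subspace_dim (P : 'cV[C]_(dimF Ns) -> Prop) (d : nat) : Prop :=
  exists B : 'M[C]_(d, dimF Ns),
    row_free B /\ forall v : 'cV[C]_(dimF Ns), P v <-> (v^T <= B)%MS.

End Fock.

(* Main.v *)
(** For a single-occupancy configuration without adjacent holes, a
    nearest-neighbour hop has amplitude [-t] (around the ring it passes the
    [Ne - 1] other electrons, an even number), and a [t'] hop exchanges the mover
    with exactly one electron, which turns [+t'] into [-t'].  So the effective
    Hamiltonian has nonpositive entries and, with any ground state [v], the
    vector [|v|] is a ground state too.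

    The configurations with a given number of up spins are connected: reading the
    ring as a sequence of tiles "electron" and "hole, electron", the [t] hops
    permute the two kinds of tiles at a fixed sequence of spins, moving the starting
    point past either kind of tile rotates the sequence, and a [t'] hop exchanges
    two neighbouring spins.  Hence a ground state that vanishes at one
    configuration vanishes on its whole sector, so each sector carries at most one
    ground state.  As the amplitudes do not depend on the spins, summing a
    ground state over the spins yields a positive function [g] of the occupied
    sites, and [g] is a ground state in each of the [Ne + 1] sectors.  These
    states are symmetric in the spins, so they have spin [Ne / 2]. *)
Require Import Defs.
From HB Require Import structures.
From mathcomp Require Import all_boot all_order all_algebra.
From mathcomp Require Import fingroup perm spectral sesquilinear zify ring.
Import Order.TTheory GRing.Theory Num.Theory.
Local Open Scope ring_scope.

Set Implicit Arguments. Unset Strict Implicit. Unset Printing Implicit Defensive.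

(** * Lowest eigenvalue of Hermitian matrices, and the case of nonpositive entries *)

Section MinimalEigenvalue.
Variable C : numClosedFieldType.

Local Open Scope sesquilinear_scope.

(** In an orthonormal eigenbasis, the form of [A] minus [E] times the squared norm is a sum of terms
    [(d_i - E) |w_i|^2], with [E] the least [d_i]. All terms are nonnegative, so equality in the
    variational bound kills each of them; this is how a minimizer is recognized as an
    eigenvector. *)
Lemma hermitian_min_eigenvalue n (A : 'M[C]_n) : (0 < n)%N -> A \is hermsymmx ->
  exists E : C,
    [/\ exists2 v : 'cV[C]_n, v != 0 & A *m v = E *: v,
        forall u : 'cV[C]_n, E * (u^t* *m u) 0 0 <= (u^t* *m A *m u) 0 0
      & forall u : 'cV[C]_n,
          (u^t* *m A *m u) 0 0 = E * (u^t* *m u) 0 0 -> A *m u = E *: u].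
Proof.
move=> n_gt0 Ah.
have /orthomx_spectralP Aeq := hermitian_normalmx Ah.
have dreal := hermitian_spectral_diag_real Ah.
have PU := spectral_unitarymx A.
set P := spectralmx A in Aeq PU; set d := spectral_diag A in Aeq dreal.
have Pu : P \in unitmx by exact: unitarymx_unit.
have dr i : d 0 i \is Num.real by move/mxOverP: dreal; apply.
have [i0 _ dmin] := @real_arg_minP C _ (Ordinal n_gt0) predT (d 0) isT
  (fun i _ => dr i).
set E := d 0 i0.
have PtP : P^t* *m P = 1%:M by rewrite -invmx_unitary // mulVmx.
have sq (w : 'cV[C]_n) : (w^t* *m w) 0 0 = \sum_i `|w i 0| ^+ 2.
  by rewrite mxE; apply: eq_bigr => i _; rewrite !mxE mulrC -normCK.
have nrm (u : 'cV[C]_n) : (u^t* *m u) 0 0 = \sum_i `|(P *m u) i 0| ^+ 2.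
  rewrite -sq trmx_mul map_mxM -mulmxA; congr ((_ *m _) 0 0).
  by rewrite mulmxA PtP mul1mx.
have form (u : 'cV[C]_n) :
    (u^t* *m A *m u) 0 0 = \sum_i d 0 i * `|(P *m u) i 0| ^+ 2.
  rewrite Aeq (invmx_unitary PU).
  transitivity (((P *m u)^t* *m (diag_mx d *m (P *m u))) 0 0).
    by rewrite trmx_mul map_mxM !mulmxA.
  rewrite mxE; apply: eq_bigr => i _; rewrite mul_diag_mx [X in _ * X]mxE.
  by rewrite mulrCA normCK [_^t* _ _]mxE [_^T _ _]mxE; congr (_ * _); rewrite mulrC.
have ge0 (u : 'cV[C]_n) i : true -> 0 <= (d 0 i - E) * `|(P *m u) i 0| ^+ 2.
  by move=> _; rewrite mulr_ge0 ?exprn_ge0 // subr_ge0 dmin.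
have diff (u : 'cV[C]_n) : (u^t* *m A *m u) 0 0 - E * (u^t* *m u) 0 0
    = \sum_i (d 0 i - E) * `|(P *m u) i 0| ^+ 2.
  rewrite form nrm mulr_sumr -sumrB; apply: eq_bigr => i _.
  by rewrite mulrBl.
have eigP (u : 'cV[C]_n) :
    (forall i, (d 0 i - E) * (P *m u) i 0 = 0) -> A *m u = E *: u.
  move=> Hu; rewrite Aeq -!mulmxA.
  have -> : diag_mx d *m (P *m u) = E *: (P *m u).
    apply/matrixP => i j; rewrite ord1 mul_diag_mx !mxE.
    by apply/eqP; rewrite -subr_eq0 -mulrBl; apply/eqP; have := Hu i; rewrite mxE.
  by rewrite -scalemxAr mulmxA mulVmx // mul1mx.
exists E; split.
- exists (invmx P *m delta_mx i0 0).
    apply/eqP => /(congr1 (mulmx P)); rewrite mulKVmx // mulmx0 => /matrixP /(_ i0 0).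
    by rewrite !mxE !eqxx => /eqP; rewrite oner_eq0.
  apply: eigP => i; rewrite mulKVmx // mxE eqxx andbT.
  by case: eqP => [->|_]; rewrite ?subrr ?mul0r ?mulr0.
- by move=> u; rewrite -subr_ge0 diff sumr_ge0 // => i; exact: ge0.
move=> u equ; apply: eigP => i.
have s0 : \sum_i (d 0 i - E) * `|(P *m u) i 0| ^+ 2 = 0.
  by rewrite -diff equ subrr.
have /(_ i isT)/eqP := @psumr_eq0P _ _ predT _ (ge0 u) s0.
rewrite mulf_eq0 => /orP[/eqP->|]; first by rewrite mul0r.
by rewrite expf_eq0 /= normr_eq0 => /eqP->; rewrite mulr0.
Qed.

(** Eigenvectors of the block of [A] indexed by [D]; the values of [f] outside [D] are
    unconstrained. *)
Definition eigenfun (I : finType) (D : {pred I}) (A : I -> I -> C)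
    (f : I -> C) (E : C) : Prop :=
  {in D, forall x, \sum_(y in D) A x y * f y = E * f x}.

(* Replacing [f] by [`|f|] does not increase the Rayleigh quotient, because
   all entries of [A] are nonpositive. *)
Lemma nonpos_min_eigenvalue (I : finType) (D : {pred I}) (A : I -> I -> C) :
  (exists x, x \in D) ->
  {in D &, forall x y, A x y = A y x} -> {in D &, forall x y, A x y <= 0} ->
  exists E : C,
    [/\ exists2 f, (exists2 x, x \in D & f x != 0) & eigenfun D A f E,
        forall l f, (exists2 x, x \in D & f x != 0) -> eigenfun D A f l -> E <= l
      & forall f, eigenfun D A f E -> eigenfun D A (fun x => `|f x|) E].
Proof.
move=> [x0 Dx0] Asym Ale0.
have n_gt0 : (0 < #|D|)%N by apply/card_gt0P; exists x0.
pose M : 'M[C]_#|D| := \matrix_(i, j) A (enum_val i) (enum_val j).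
have Mh : M \is hermsymmx.
  apply: realsym_hermsym.
    apply/is_hermitianmxP; rewrite expr0 scale1r map_mx_id //.
    by apply/matrixP => i j; rewrite !mxE Asym ?enum_valP.
  apply/mxOverP => i j; rewrite mxE; apply: ler0_real.
  by apply: Ale0; exact: enum_valP.
have [E [[v vN0 Mv] Emin Eeq]] := hermitian_min_eigenvalue n_gt0 Mh.
pose vec (f : I -> C) : 'cV[C]_#|D| := \col_i f (enum_val i).
have MvecE f l : eigenfun D A f l <-> M *m vec f = l *: vec f.
  split=> [ef|eqM x Dx].
    apply/matrixP => i j; rewrite !mxE -(ef _ (enum_valP i)) [RHS]big_enum_val.
    by apply: eq_bigr => k _; rewrite !mxE.
  have /matrixP /(_ (enum_rank_in Dx x) 0) := eqM.
  rewrite !mxE enum_rankK_in // => <-; rewrite [LHS]big_enum_val.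
  by apply: eq_bigr => k _; rewrite !mxE /= enum_rankK_in.
have form f : ((vec f)^t* *m M *m vec f) 0 0
    = \sum_i \sum_j M i j * ((f (enum_val i))^* * f (enum_val j)).
  rewrite -mulmxA mxE; apply: eq_bigr => i _; rewrite [X in _ * X]mxE mulr_sumr.
  by apply: eq_bigr => j _; rewrite !mxE mulrCA.
have nrmE f : ((vec f)^t* *m vec f) 0 0 = \sum_(i < #|D|) `|f (enum_val i)| ^+ 2.
  by rewrite mxE; apply: eq_bigr => i _; rewrite !mxE mulrC -normCK.
have Ml f l : eigenfun D A f l ->
    ((vec f)^t* *m M *m vec f) 0 0 = l * ((vec f)^t* *m vec f) 0 0.
  by move=> /MvecE eqM; rewrite -mulmxA eqM -scalemxAr mxE.
have npos f : (exists2 x, x \in D & f x != 0) -> 0 < ((vec f)^t* *m vec f) 0 0.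
  move=> [x Dx fx]; rewrite nrmE lt_neqAle sumr_ge0 ?andbT; last first.
    by move=> i _; rewrite exprn_ge0.
  apply/negP => /eqP/esym s0.
  have /= := @psumr_eq0P C _ predT _ (fun i _ => exprn_ge0 2 (normr_ge0 _)) s0.
  move=> /(_ (enum_rank_in Dx x) isT) /eqP.
  by rewrite enum_rankK_in // expf_eq0 /= normr_eq0 (negPf fx).
have MleN f : ((vec (fun x => `|f x|))^t* *m M *m vec (fun x => `|f x|)) 0 0
    <= \sum_i \sum_j - `|M i j * ((f (enum_val i))^* * f (enum_val j))|.
  rewrite form le_eqVlt; apply/orP; left; apply/eqP.
  apply: eq_bigr => i _; apply: eq_bigr => j _.
  rewrite !normrM norm_conjC (conj_Creal (normr_real _)).
  by rewrite [X in - (X * _)]ler0_norm ?mulNr ?opprK // mxE Ale0 ?enum_valP.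
exists E; split.
(* This is [v] extended by zero: the sum has one term for [x] in [D] and none outside. *)
- exists (fun x => \sum_(i | enum_val i == x) v i 0).
    move/eqP: vN0 => vN0; have [i vi0] : exists i, v i 0 != 0.
      apply/existsP; apply: contra_notT vN0; rewrite negb_exists => /forallP v0.
      by apply/matrixP => i j; rewrite ord1 mxE; apply/eqP/negPn.
    exists (enum_val i); first exact: enum_valP.
    by rewrite (big_pred1 i) // => j; rewrite (inj_eq enum_val_inj).
  apply/MvecE; suff -> : vec (fun x => \sum_(i | enum_val i == x) v i 0) = v by [].
  apply/matrixP => i j; rewrite ord1 !mxE.
  by rewrite (big_pred1 i) // => k; rewrite (inj_eq enum_val_inj).
- move=> l f fN0 /Ml fl; have := Emin (vec f).
  by rewrite fl ler_pM2r // npos.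
move=> f ef; apply/MvecE; apply: Eeq; apply/eqP; rewrite eq_le Emin andbT.
have -> : ((vec (fun x => `|f x|))^t* *m vec (fun x => `|f x|)) 0 0
   = ((vec f)^t* *m vec f) 0 0.
  by rewrite !nrmE; apply: eq_bigr => i _; rewrite normr_id.
rewrite -Ml //; apply: (le_trans (MleN f)); rewrite form.
(* The form is real because [M] is Hermitian; hence it is at least minus its modulus, and the
   triangle inequality concludes. *)
have rl : \sum_i \sum_j M i j * ((f (enum_val i))^* * f (enum_val j)) \is Num.real.
  rewrite -form; apply/CrealP.
  have := @erefl _ ((((vec f)^t* *m M *m vec f)^t*) 0 0).
  rewrite {1}mxE [_^T _ _]mxE => ->.
  rewrite trmx_mul map_mxM trmx_mul map_mxM trmxCK.
  have := is_hermitianmxP _ _ _ Mh; rewrite expr0 scale1r => <-.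
  by rewrite mulmxA.
apply: le_trans (real_lerNnormlW rl (lexx _)).
have -> : \sum_i \sum_j - `|M i j * ((f (enum_val i))^* * f (enum_val j))|
  = - \sum_i \sum_j `|M i j * ((f (enum_val i))^* * f (enum_val j))|.
  by rewrite -sumrN; apply: eq_bigr => i _; rewrite -sumrN.
rewrite lerN2; apply: (le_trans (ler_norm_sum _ _ _)).
by apply: ler_sum => i _; exact: ler_norm_sum.
Qed.

(** At a zero of [f] the eigenvalue equation is a vanishing sum of nonpositive terms, so every term
    is zero. *)
Lemma eigenfun_zero (I : finType) (D : {pred I}) (A : I -> I -> C) f E :
  {in D &, forall x y, A x y <= 0} -> (forall x, 0 <= f x) -> eigenfun D A f E ->
  {in D &, forall x y, A x y != 0 -> f x = 0 -> f y = 0}.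
Proof.
move=> Ale0 f_ge0 ef x y Dx Dy Axy fx0.
have := ef x Dx; rewrite fx0 mulr0 => s0.
have s1 : \sum_(y in D) - (A x y * f y) = 0 by rewrite sumrN s0 oppr0.
have s2 z : z \in D -> 0 <= - (A x z * f z).
  by move=> Dz; rewrite -mulNr mulr_ge0 // oppr_ge0 Ale0.
have /(_ y Dy)/eqP := psumr_eq0P s2 s1; rewrite oppr_eq0 mulf_eq0 (negPf Axy).
by move/eqP.
Qed.

End MinimalEigenvalue.

(** * Occupation patterns on the ring and parities of electron counts *)

Section Configurations.
Variable Ns : nat.
Implicit Types (S T : fock Ns) (x y z : 'I_Ns).

Definition occ S x : bool := ((x, true) \in S) || ((x, false) \in S).

Definition nodbl S : bool := [forall x, ~~ (((x, true) \in S) && ((x, false) \in S))].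

(** A hop of an electron to an empty site is encoded as an exchange of the contents of the two
    sites: an involution that needs no case distinction on spin or direction. *)
Definition sw x y S : fock Ns := [set m | (tperm x y m.1, m.2) \in S].

Definition pos S : {set 'I_Ns} := [set x | occ S x].

Definition nup S : nat := #|[set x | (x, true) \in S]|.

(** Strictly between in the linear order of labels, not along the ring: this is the order that the
    Jordan-Wigner signs see. *)
Definition btw x y z : bool := (x < z < y)%N || (y < z < x)%N.

Lemma nodblN S x s : nodbl S -> (x, s) \in S -> (x, ~~ s) \notin S.
Proof. by move=> /forallP/(_ x); case: s => /=; do 2!case: (_ \in S). Qed.

Lemma occ_in S x s : (x, s) \in S -> occ S x.
Proof. by rewrite /occ; case: s => ->; rewrite ?orbT. Qed.

Lemma noccE S x : nodbl S -> nocc S x = occ S x.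
Proof. by move=> /forallP/(_ x); rewrite /nocc /occ; do 2!case: (_ \in S). Qed.

Lemma card_fock_cond (P : pred 'I_Ns) S :
  #|[set m in S | P m.1]| = (\sum_(x | P x) nocc S x)%N.
Proof.
rewrite -sum1_card (eq_bigl (fun m : mode Ns => P m.1 && (m \in S))); last first.
  by move=> m; rewrite !inE andbC.
rewrite big_mkcondr /=.
transitivity (\sum_(x | P x) \sum_(s : bool) (if (x, s) \in S then 1 else 0))%N.
  by rewrite pair_big; apply: eq_big => -[x s] //=; rewrite andbT.
apply: eq_bigr => x _; rewrite big_bool /nocc /=.
by do 2!case: (_ \in S).
Qed.

Lemma card_fock S : #|S| = (\sum_x nocc S x)%N.
Proof.
rewrite -(card_fock_cond predT); congr #|pred_of_set _|.
by apply/setP => m; rewrite !inE andbT.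
Qed.

Lemma nxt_inj : injective (@nxt Ns).
Proof.
move=> x y /(congr1 val) /= /eqP.
by rewrite -addn1 -(addn1 y) eqn_modDr !modn_small // => /eqP/val_inj.
Qed.

Lemma nxt_bij : bijective (@nxt Ns).
Proof. exact: injF_bij nxt_inj. Qed.

Lemma card_pos S : nodbl S -> #|S| = #|pos S|.
Proof.
move=> ndS; rewrite card_fock -sum1_card [RHS]big_mkcond /=.
by apply: eq_bigr => x _; rewrite noccE // inE; case: occ.
Qed.

(* With [n + h = 1] on every site, the bond sum exceeds its minimum
   [2 Ne - Ns] by the number of adjacent pairs of holes. *)
Lemma allowedP Ne S : (Ns <= 2 * Ne)%N ->
  reflect [/\ #|S| = Ne, nodbl S & forall x, occ S x || occ S (nxt x)]
          (allowed Ne S).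
Proof.
move=> le_Ns.
(* Stated with sums only, so that no truncated subtraction occurs; [le_Ns] makes the subtraction in
   [allowed] a true one. *)
have key : nodbl S ->
    (\sum_(x : 'I_Ns) nocc S x * nocc S (nxt x) + 2 * Ns
     = 2 * #|S| + Ns + \sum_(x : 'I_Ns) ~~ (occ S x || occ S (nxt x)))%N.
  move=> ndS.
  have e1 : #|S| = (\sum_(x : 'I_Ns) occ S x)%N.
    by rewrite card_fock; apply: eq_bigr => x _; rewrite noccE.
  have e2 : #|S| = (\sum_(x : 'I_Ns) occ S (nxt x))%N.
    by rewrite e1 (reindex _ (onW_bij _ nxt_bij)).
  have : (\sum_(x : 'I_Ns) (nocc S x * nocc S (nxt x) + 1 + 1)
      = \sum_(x : 'I_Ns) (occ S x + occ S (nxt x) + 1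
                          + ~~ (occ S x || occ S (nxt x))))%N.
    by apply: eq_bigr => x _; rewrite !noccE //; do 2!case: occ.
  by rewrite !big_split /= -e1 -e2 sum1_card card_ord !mul2n -!addnn !addnA.
apply: (iffP and3P) => [[/eqP cS ndS /eqP sS]|[cS ndS hS]].
  split=> // x; apply: contraPT (key ndS) => hx; rewrite sS cS.
  by rewrite [X in _ = (_ + X)%N](bigD1 x) //= hx; lia.
split=> //; first exact/eqP.
have := key ndS; rewrite [X in _ = (_ + X)%N]big1 => [|x _]; last by rewrite hS.
by rewrite cS => ?; apply/eqP; lia.
Qed.

Lemma swK x y : involutive (sw x y).
Proof. by move=> S; apply/setP => -[z s]; rewrite !inE /= tpermK. Qed.

Lemma occ_sw x y S z : occ (sw x y S) z = occ S (tperm x y z).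
Proof. by rewrite /occ !inE. Qed.

Lemma nodbl_sw x y S : nodbl (sw x y S) = nodbl S.
Proof.
have imp T : nodbl T -> nodbl (sw x y T).
  by move=> /forallP nd; apply/forallP => z; rewrite !inE /=; exact: nd.
by apply/idP/idP => [/imp|]; [rewrite swK | exact: imp].
Qed.

Lemma pos_sw x y S : pos (sw x y S) = tperm x y @^-1: pos S.
Proof. by apply/setP => z; rewrite !inE occ_sw. Qed.

Lemma nup_sw x y S : nup (sw x y S) = nup S.
Proof.
have bij : bijective (tperm x y) by exists (tperm x y); exact: tpermK.
rewrite /nup -[RHS](on_card_preimset (onW_bij _ bij)).
by apply: eq_card => z; rewrite !inE.
Qed.

(** Away from the seam no site lies between [x] and its successor. Across the seam every other
    electron does, and there are [#|T| - 1] of them. *)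
Lemma even_btw_nxt x T : nodbl T -> odd #|T| -> occ T x != occ T (nxt x) ->
  ~~ odd #|[set m in T | btw x (nxt x) m.1]|.
Proof.
move=> ndT oT oxy; rewrite card_fock_cond.
have xy : x != nxt x by apply: contraNneq oxy => <-.
have := ltn_ord x; rewrite leq_eqVlt => /orP[/eqP xN|xN]; last first.
  rewrite big_pred0 // => z; rewrite /btw /= modn_small //; lia.
have := oT; rewrite card_fock (bigID (btw x (nxt x))) /=.
rewrite [X in odd (_ + X)](bigD1 x) /=; last by rewrite /btw /= xN modnn; lia.
rewrite [X in odd (_ + (_ + X))](bigD1 (nxt x)) /=; last first.
  by rewrite eq_sym xy andbT /btw /= xN modnn; lia.
rewrite [X in odd (_ + (_ + (_ + X)))]big_pred0 => [|z]; last first.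
  have := ltn_ord z; rewrite /btw -!val_eqE /= xN modnn.
  by case: (val z) => [|k] ; lia.
rewrite !noccE //; case: (occ T x) oxy; case: (occ T (nxt x)) => //= _;
  by rewrite oddD /= addbT.
Qed.

(** One end is empty, so the middle site is occupied. Away from the seam its electron is the only
    one in between; across the seam all electrons are in between except the mover and the middle
    one, which leaves [#|T| - 2]. *)
Lemma odd_btw_nxt2 x T : ~~ odd Ns -> odd x -> nodbl T -> odd #|T| ->
  (forall z, occ T z || occ T (nxt z)) -> occ T x != occ T (nxt (nxt x)) ->
  odd #|[set m in T | btw x (nxt (nxt x)) m.1]|.
Proof.
move=> eN ox ndT oT hT oxy; rewrite card_fock_cond.
have xy : x != nxt (nxt x) by apply: contraNneq oxy => <-.
have o1 : occ T (nxt x).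
  by have := hT x; have := hT (nxt x); case: (occ T (nxt x)) => //=;
     rewrite orbF => o2 o1; rewrite o1 o2 in oxy.
have xN := ltn_ord x.
have [lt2|ge2] := ltnP x.+2 Ns.
  have v1 : val (nxt x) = x.+1 by rewrite /= modn_small //; lia.
  have v2 : val (nxt (nxt x)) = x.+2.
    have -> : val (nxt (nxt x)) = ((val (nxt x)).+1 %% Ns)%N by [].
    by rewrite v1 modn_small.
  rewrite (big_pred1 (nxt x)) ?noccE ?o1 // => z.
  by rewrite /btw v2 /= -val_eqE v1 /=; lia.
(* Parity excludes [x = Ns - 2], so the only bond across the seam starts at the last site. *)
have xE : x.+1 = Ns by lia.
have v1 : val (nxt x) = 0%N by rewrite /= xE modnn.
have v2 : val (nxt (nxt x)) = 1%N.
  have -> : val (nxt (nxt x)) = ((val (nxt x)).+1 %% Ns)%N by [].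
  by rewrite v1 modn_small //; lia.
have x1 : (1 < x)%N by move: xy; rewrite -val_eqE v2 /=; lia.
have := oT; rewrite card_fock (bigID (btw x (nxt (nxt x)))) /=.
rewrite [X in odd (_ + X)](bigD1 x) /=; last by rewrite /btw v2; lia.
rewrite [X in odd (_ + (_ + X))](bigD1 (nxt (nxt x))) /=; last first.
  by rewrite eq_sym xy andbT /btw v2; lia.
rewrite [X in odd (_ + (_ + (_ + X)))](bigD1 (nxt x)) /=; last first.
  by rewrite -!val_eqE v1 v2 /btw v2 v1 /=; lia.
rewrite [X in odd (_ + (_ + (_ + (_ + X))))]big_pred0 => [|z]; last first.
  by have := ltn_ord z; rewrite -!val_eqE v1 v2 /btw v2 /=; lia.
rewrite !noccE // o1; case: (occ T x) oxy; case: (occ T (nxt (nxt x))) => //= _;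
  by rewrite oddD /= addbF.
Qed.

End Configurations.

(** * Matrix elements of the hopping terms and the effective Hamiltonian *)

Section Operators.
Variables (C : numClosedFieldType) (Ns : nat).
Implicit Types (S T R : fock Ns) (x y z : 'I_Ns).

Definition amp (v : 'cV[C]_(dimF Ns)) S : C := v (enum_rank S) 0.

Definition vec_of (f : fock Ns -> C) : 'cV[C]_(dimF Ns) := \col_i f (enum_val i).

Lemma amp_vec_of f S : amp (vec_of f) S = f S.
Proof. by rewrite /amp mxE enum_rankK. Qed.

Lemma amp_inj v w : amp v =1 amp w -> v = w.
Proof.
move=> vw; apply/matrixP => i j; rewrite ord1.
by have := vw (enum_val i); rewrite /amp enum_valK.
Qed.

Lemma ampZ a v S : amp (a *: v) S = a * amp v S.
Proof. by rewrite /amp mxE. Qed.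

Lemma sum_enum_fock (F : fock Ns -> C) :
  \sum_(i < dimF Ns) F (enum_val i) = \sum_S F S.
Proof.
rewrite (reindex_onto enum_rank enum_val) => [|i _]; last exact: enum_valK.
by apply: eq_big => [S|S _]; rewrite ?enum_rankK ?eqxx.
Qed.

Lemma amp_opmx F v S : amp (opmx F *m v) S = \sum_T F S T * amp v T.
Proof.
rewrite /amp mxE -sum_enum_fock; apply: eq_bigr => i _.
by rewrite mxE enum_rankK /amp enum_valK.
Qed.

Lemma eq_opmx (F G : fock Ns -> fock Ns -> C) : F =2 G -> opmx F = opmx G.
Proof. by move=> FG; apply/matrixP => i j; rewrite !mxE FG. Qed.

Lemma opmxM (F G : fock Ns -> fock Ns -> C) :
  opmx F *m opmx G = opmx (fun S T => \sum_R F S R * G R T).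
Proof.
apply/matrixP => i j; rewrite !mxE -sum_enum_fock.
by apply: eq_bigr => k _; rewrite !mxE.
Qed.

Lemma opmxD (F G : fock Ns -> fock Ns -> C) :
  opmx F + opmx G = opmx (fun S T => F S T + G S T).
Proof. by apply/matrixP => i j; rewrite !mxE. Qed.

Lemma opmxZ a (F : fock Ns -> fock Ns -> C) :
  a *: opmx F = opmx (fun S T => a * F S T).
Proof. by apply/matrixP => i j; rewrite !mxE. Qed.

Lemma opmx_sum (I : finType) (F : I -> fock Ns -> fock Ns -> C) :
  \sum_i opmx (F i) = opmx (fun S T => \sum_i F i S T).
Proof.
by apply/matrixP => i j; rewrite summxE mxE; apply: eq_bigr => k _; rewrite mxE.
Qed.

(** The matrix element of [ccre p *m cann q] between the basis states [S] and [T]. *)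
Definition he (p q : mode Ns) S T : C :=
  if [&& q \in T, p \notin T :\ q & S == p |: (T :\ q)]
  then jwsign C T q * jwsign C (T :\ q) p else 0.

Lemma ccre_cann p q : ccre C p *m cann C q = opmx (he p q).
Proof.
rewrite opmxM; apply: eq_opmx => S T; rewrite /he.
rewrite (bigD1 (T :\ q)) //= big1 ?addr0 => [|R /negPf RT]; last first.
  by rewrite RT andbF mulr0.
by rewrite eqxx andbT; case: (q \in T); case: ifP; rewrite ?mulr0 ?mul0r // mulrC.
Qed.

Lemma jwsignE T m :
  jwsign C T m = \prod_(k in T) (-1) ^+ (midx k < midx m)%N.
Proof.
rewrite /jwsign -sum1_card expr_sum (eq_bigl (fun k => (k \in T) && (midx k < midx m)%N)).
  rewrite big_mkcondr; apply: eq_bigr => k _.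
  by case: ifP; rewrite ?expr1 ?expr0.
by move=> k; rewrite !inE.
Qed.

Lemma jwsignD1 T p q : jwsign C (T :\ q) p
  = \prod_(k in T) (-1) ^+ ((k != q) && (midx k < midx p)%N).
Proof.
rewrite jwsignE (eq_bigl (fun k => (k \in T) && (k != q))); last first.
  by move=> k; rewrite !inE andbC.
by rewrite big_mkcondr; apply: eq_bigr => k _; case: eqP; rewrite /= ?expr0.
Qed.

(** Each electron contributes a factor to both signs. The two factors cancel unless its site lies
    strictly between [x] and [y]; its spin is irrelevant because [x] is empty and [y] carries only
    the mover. *)
Lemma jwsign_hop T x y s : x != y -> nodbl T -> (y, s) \in T -> ~~ occ T x ->
  jwsign C T (y, s) * jwsign C (T :\ (y, s)) (x, s)
    = (-1) ^+ #|[set m in T | btw x y m.1]|.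
Proof.
move=> xy ndT yT xT.
have -> : (-1) ^+ #|[set m in T | btw x y m.1]|
    = \prod_(k in T) (-1) ^+ btw x y k.1 :> C.
  rewrite -sum1_card expr_sum (eq_bigl (fun k => (k \in T) && btw x y k.1)).
    by rewrite big_mkcondr; apply: eq_bigr => k _; case: btw; rewrite ?expr1 ?expr0.
  by move=> k; rewrite !inE.
rewrite jwsignE jwsignD1 -big_split /=; apply: eq_bigr => -[z u] zT.
rewrite -exprD; suff e : odd ((midx (z, u) < midx (y, s))
    + ((z, u) != (y, s)) && (midx (z, u) < midx (x, s)))%N = odd (btw x y z).
  by rewrite -[LHS]signr_odd e signr_odd.
have zx : z != x by apply: contraNneq xT => <-; exact: occ_in zT.
have [[-> ->]|zy'] := altP ((z, u) =P (y, s)).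
  by rewrite ltnn /btw /=; lia.
have zy : z != y.
  apply: contraNneq zy' => zy; rewrite zy in zT *.
  have := nodblN ndT yT; case: (eqVneq u s) => [->//|us].
  have su : ~~ s = u by case: (s) (u) us => [] [].
  by rewrite su zT.
move: zx zy xy; rewrite -!val_eqE /midx /btw /=.
by case: (s); case: (u) => /=; lia.
Qed.

Lemma sw_hop T x y s : x != y -> nodbl T -> (y, s) \in T -> ~~ occ T x ->
  (x, s) |: (T :\ (y, s)) = sw x y T.
Proof.
move=> xy ndT yT; rewrite /occ negb_or => /andP[x1 x2].
have xN u : (x, u) \in T = false by case: u; apply/negbTE.
have yE u : (y, u) \in T = (u == s).
  have [->//|us] := eqVneq u s.
  have -> : u = ~~ s by case: (u) (s) us => [] [].
  exact/negbTE/nodblN.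
apply/setP => -[z u]; rewrite !inE !xpair_eqE /=.
case: tpermP => [->|->|/eqP zx /eqP zy].
- by rewrite xN andbF orbF eqxx yE.
- by rewrite eqxx xN yE (eq_sym y) (negPf xy) /=; case: eqP.
- by rewrite (negPf zx) (negPf zy).
Qed.

(** If [x] is already occupied, the move is either forbidden by the Pauli principle or creates a
    double occupancy, which [nodbl S] rules out. *)
Lemma he_hop S T x y s : x != y -> nodbl S -> nodbl T ->
  he (x, s) (y, s) S T = if [&& (y, s) \in T, ~~ occ T x & S == sw x y T]
    then (-1) ^+ #|[set m in T | btw x y m.1]| else 0.
Proof.
move=> xy ndS ndT; rewrite /he; have [yT|//] := boolP ((y, s) \in T).
have [xT|xT] /= := boolP (occ T x); last first.
  have -> : (x, s) \in T :\ (y, s) = false.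
    by rewrite !inE; apply/negbTE; rewrite negb_and (contra (@occ_in _ _ _ _) xT) orbT.
  by rewrite /= sw_hop //; case: ifP => // _; rewrite jwsign_hop.
case: ifP => // /andP[xs /eqP SE]; have [u xu] : exists u, (x, u) \in T.
  by case/orP: xT; [exists true | exists false].
have xuS : (x, u) \in T :\ (y, s) by rewrite !inE xu xpair_eqE (negPf xy).
have us : u = ~~ s.
  by case: (eqVneq u s) (xuS) => [->|]; [rewrite (negPf xs) | case: (u) (s) => [] []].
have : (x, s) \in S by rewrite SE !inE eqxx.
by move=> /(nodblN ndS); rewrite SE -us in_setU1 xuS orbT.
Qed.

Definition hops x y S T : bool := (occ T x != occ T y) && (S == sw x y T).

(** Of the four terms (two spins, two directions) at most one survives: the electron present on the
    bond fixes both spin and direction. *)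
Lemma bond_hop S T x y : x != y -> nodbl S -> nodbl T ->
  \sum_(s : bool) (he (x, s) (y, s) S T + he (y, s) (x, s) S T)
    = (hops x y S T)%:R * (-1) ^+ #|[set m in T | btw x y m.1]|.
Proof.
move=> xy ndS ndT; have yx : y != x by rewrite eq_sym.
have swC : sw y x T = sw x y T by rewrite /sw tpermC.
have btwC : [set m in T | btw y x m.1] = [set m in T | btw x y m.1].
  by apply/setP => m; rewrite !inE /btw orbC.
rewrite big_bool /= !he_hop // swC btwC /hops /occ.
have := forallP ndT x; have := forallP ndT y.
set c := (-1) ^+ _; set a := _ == sw _ _ _.
case: ((x, true) \in T); case: ((x, false) \in T); case: ((y, true) \in T);
  case: ((y, false) \in T); case: a => //= _ _; by rewrite ?addr0 ?add0r ?mul0r ?mul1r.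
Qed.

Section Ring.
Hypothesis Ns_gt0 : (0 < Ns)%N.

Definition osite (k : nat) : 'I_Ns := Ordinal (ltn_pmod k Ns_gt0).

Lemma osite_val x : osite x = x.
Proof. by apply: val_inj; rewrite /= modn_small. Qed.

Lemma nxt_osite k : nxt (osite k) = osite k.+1.
Proof. by apply: val_inj; rewrite /= -[_.+1 in LHS]addn1 modnDml addn1. Qed.

Lemma cann_atE k s : cann_at C Ns k s = cann C (osite k, s).
Proof. by rewrite /cann_at (big_pred1 (osite k)). Qed.

Lemma ccre_atE k s : ccre_at C Ns k s = ccre C (osite k, s).
Proof. by rewrite /ccre_at (big_pred1 (osite k)). Qed.

Definition bent x y S T : C :=
  \sum_(s : bool) (he (x, s) (y, s) S T + he (y, s) (x, s) S T).

Lemma bondE a b : bond C Ns a b = opmx (bent (osite a) (osite b)).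
Proof.
rewrite /bond -opmx_sum; apply: eq_bigr => s _.
by rewrite !cann_atE !ccre_atE !ccre_cann opmxD.
Qed.

(** One index type for all bonds: [inl] for the [t] bonds, [inr] for the [t'] bonds, which join
    consecutive sites of odd 0-based label. *)
Definition bleft (b : 'I_Ns + 'I_Ns./2) : 'I_Ns :=
  match b with inl x => x | inr j => osite (2 * j).+1 end.

Definition bright (b : 'I_Ns + 'I_Ns./2) : 'I_Ns :=
  match b with inl x => nxt x | inr j => nxt (nxt (osite (2 * j).+1)) end.

Definition bweight (t t' : C) (b : 'I_Ns + 'I_Ns./2) : C :=
  if b is inl _ then t else t'.

Definition hopb b := hops (bleft b) (bright b).

(** Both kinds of bond carry a minus sign here: the exchange with the middle electron has been
    absorbed into the [t'] terms. *)
Definition hopmx (t t' : C) S T : C := - \sum_b bweight t t' b * (hopb b S T)%:R.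

Lemma HhopE t t' : Hhop Ns t t' = opmx (fun S T =>
  - t * (\sum_x bent x (nxt x) S T)
  + t' * (\sum_j bent (bleft (inr j)) (bright (inr j)) S T)).
Proof.
rewrite /Hhop -opmxD -!opmxZ -!opmx_sum; congr (_ *: _ + _ *: _).
  by apply: eq_bigr => x _; rewrite bondE -nxt_osite osite_val.
by apply: eq_bigr => j _; rewrite bondE /= !nxt_osite.
Qed.

Section Allowed.
Variable Ne : nat.
Hypotheses (evenN : ~~ odd Ns) (oddNe : odd Ne) (Ns_le : (Ns <= 2 * Ne)%N).
Hypothesis Ns_gt2 : (2 < Ns)%N.

Lemma bent_nn S T x : allowed Ne S -> allowed Ne T ->
  bent x (nxt x) S T = (hops x (nxt x) S T)%:R.
Proof.
move=> /(allowedP _ Ns_le)[_ ndS _] /(allowedP _ Ns_le)[cT ndT _].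
have xy : x != nxt x.
  by rewrite -val_eqE /=; have [?|?] := ltnP x.+1 Ns;
    [rewrite modn_small | have -> : x.+1 = Ns by have := ltn_ord x; lia]; rewrite ?modnn; lia.
rewrite /bent bond_hop //; have [/andP[oxy _]|_] := boolP (hops _ _ _ _); last by rewrite mul0r.
by rewrite -signr_odd (negPf (even_btw_nxt ndT _ oxy)) ?cT // expr0 mulr1.
Qed.

Lemma bent_nnn S T x : odd x -> x != nxt (nxt x) -> allowed Ne S -> allowed Ne T ->
  bent x (nxt (nxt x)) S T = - (hops x (nxt (nxt x)) S T)%:R.
Proof.
move=> ox xy /(allowedP _ Ns_le)[_ ndS _] /(allowedP _ Ns_le)[cT ndT hT].
rewrite /bent bond_hop //; have [/andP[oxy _]|_] := boolP (hops _ _ _ _);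
  last by rewrite mul0r oppr0.
by rewrite -signr_odd odd_btw_nxt2 ?cT // expr1 mulrN1.
Qed.

Lemma HeffE (t t' : C) : Heff Ns Ne t t' = opmx (fun S T =>
  if allowed Ne S && allowed Ne T then hopmx t t' S T else 0).
Proof.
rewrite /Heff HhopE /Pproj opmxM opmxM; apply: eq_opmx => S T.
(* The projections are diagonal, so both intermediate sums collapse to a single term. *)
rewrite (bigD1 T) //= [X in _ + X]big1 ?addr0 => [|R /negPf ->]; last by rewrite mulr0.
rewrite eqxx /= (bigD1 S) //= [X in _ + X]big1 ?addr0 => [|R RS]; last first.
  by rewrite eq_sym (negPf RS) mul0r.
rewrite eqxx /=.
case aS: (allowed Ne S); last by rewrite mul0r mul0r.
case aT: (allowed Ne T); last by rewrite mulr0.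
rewrite mul1r mulr1 /hopmx big_sumType /= opprD.
congr (_ + _).
  by rewrite mulNr mulr_sumr; congr (- _); apply: eq_bigr => x _; rewrite bent_nn.
rewrite mulr_sumr -sumrN; apply: eq_bigr => j _.
have jlt : ((2 * j).+1 < Ns)%N by have := ltn_ord j; lia.
rewrite bent_nnn ?mulrN //; first by rewrite /= modn_small // mul2n /= odd_double.
rewrite !nxt_osite -val_eqE /= modn_small //.
have [?|?] := ltnP (2 * j).+3 Ns; first by rewrite modn_small //; lia.
(* The last [t'] bond wraps around and ends at site 1, which differs from [Ns - 1] since
   [2 < Ns]. *)
have -> : ((2 * j).+3 = Ns + 1)%N by move: evenN; lia.
by rewrite modnDl modn_small; lia.
Qed.

Lemma amp_Pproj v S : amp (Pproj C Ns Ne *m v) S = if allowed Ne S then amp v S else 0.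
Proof.
rewrite amp_opmx (bigD1 S) //= big1 ?addr0 => [|T TS]; last first.
  by rewrite eq_sym (negPf TS) mul0r.
by rewrite eqxx /=; case: ifP; rewrite ?mul1r ?mul0r.
Qed.

(** Passes from vectors to functions on configurations, where the arguments about matrices with
    nonpositive entries apply. *)
Lemma ground_stateP (t t' E : C) v : ground_state Ne t t' E v <->
  (forall S, ~~ allowed Ne S -> amp v S = 0) /\
  eigenfun (allowed Ne) (hopmx t t') (amp v) E.
Proof.
have HE S : amp (Heff Ns Ne t t' *m v) S = if allowed Ne S then
    \sum_(T | allowed Ne T) hopmx t t' S T * amp v T else 0.
  rewrite HeffE amp_opmx; case: ifP => aS /=; last first.
    by rewrite big1 // => T _; rewrite mul0r.
  rewrite [RHS]big_mkcond; apply: eq_bigr => T _.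
  by case: ifP; rewrite ?mul0r.
split=> [[Pv Hv]|[v0 ev]].
  split=> [S /negPf aS|S aS]; first by rewrite -Pv amp_Pproj aS.
  have := HE S; rewrite Hv ampZ; have -> : allowed Ne S by exact: aS.
  by move=> <-.
split; apply: amp_inj => S; first by rewrite amp_Pproj; case: ifP => // /negbT/v0->.
rewrite HE ampZ; case: ifP => aS; first by rewrite -ev.
by rewrite v0 ?aS ?mulr0.
Qed.

End Allowed.
End Ring.
End Operators.

(** * Connecting boolean words by adjacent transpositions *)

Section BubbleSort.
Variables (T : finType) (e : rel T) (F : seq bool -> T) (n k : nat).
Hypothesis e_sym : connect_sym e.
Hypothesis e_swap : forall A B, size (A ++ true :: false :: B) = n ->
  count id (A ++ true :: false :: B) = k ->
  connect e (F (A ++ true :: false :: B)) (F (A ++ false :: true :: B)).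

(** Both words are sorted to the same normal form, all [true] letters first. This serves twice: for
    the kinds of tiles and for the spins. *)
Lemma connect_bubble s s' : size s = n -> count id s = k ->
  size s' = n -> count id s' = k -> connect e (F s) (F s').
Proof.
(* One [false] travels to the right past [c] letters [true]. *)
have slide c d A : (size A + c + d).+1 = n -> (count id A + c)%N = k ->
    connect e (F (A ++ false :: nseq c true ++ nseq d false))
              (F (A ++ nseq c true ++ nseq d.+1 false)).
  elim: c A => [|c IH] A; first by move=> _ _; exact: connect0.
  move=> sA cA /=; apply: (@connect_trans _ _ 
    (F (A ++ true :: false :: nseq c true ++ nseq d false))).
    rewrite e_sym; apply: e_swap; rewrite ?size_cat ?count_cat /=.
      by rewrite size_cat !size_nseq; lia.
    by rewrite count_cat !count_nseq /=; lia.
  rewrite -cat_rcons -[A ++ true :: nseq c true ++ _]cat_rcons.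
  by apply: IH; rewrite -cats1 ?size_cat ?count_cat /=; lia.
(* The suffix [r] is sorted behind an untouched prefix [A]. *)
have norm r A : size (A ++ r) = n -> count id (A ++ r) = k ->
    connect e (F (A ++ r))
      (F (A ++ nseq (count id r) true ++ nseq (size r - count id r) false)).
  elim: r A => [|[] r IH] A; first by move=> _ _; exact: connect0.
    move=> sA cA /=; rewrite subSS -!cat_rcons.
    by apply: IH; rewrite cat_rcons.
  move=> sA cA /=; rewrite add0n subSn ?count_size //.
  apply: (@connect_trans _ _ (F (rcons A false ++ nseq (count id r) true
     ++ nseq (size r - count id r) false))).
    by rewrite -cat_rcons; apply: IH; rewrite cat_rcons.
  rewrite cat_rcons; apply: slide.
    have := count_size id r; move: sA; rewrite size_cat /=; lia.
  by move: cA; rewrite count_cat.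
move=> ss cs ss' cs'.
have := norm s [::] ss cs; have := norm s' [::] ss' cs'.
rewrite /= ss cs ss' cs' e_sym => c1 c2; exact: connect_trans c2 c1.
Qed.

End BubbleSort.

(* A configuration without adjacent holes, read along the ring starting after an
   occupied site, is a sequence of tiles: an electron [(false, s)], or a hole
   followed by an electron [(true, s)]. *)
Definition tile (t : bool * bool) : seq (option bool) :=
  if t.1 then [:: None; Some t.2] else [:: Some t.2].

Definition word (ts : seq (bool * bool)) : seq (option bool) :=
  flatten [seq tile t | t <- ts].

Lemma word_cat ts us : word (ts ++ us) = word ts ++ word us.
Proof. by rewrite /word map_cat flatten_cat. Qed.

Lemma word_cons t ts : word (t :: ts) = tile t ++ word ts.
Proof. by []. Qed.

Lemma size_word ts : size (word ts) = (size ts + count fst ts)%N.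
Proof.
elim: ts => //= t ts IH; rewrite /word /= size_cat -/(word ts) IH.
by case: t => [[] s] /=; lia.
Qed.

Lemma count_word_isSome ts : count isSome (word ts) = size ts.
Proof.
elim: ts => //= t ts IH; rewrite /word /= count_cat -/(word ts) IH.
by case: t => [[] s].
Qed.

Lemma count_word_up ts : count (pred1 (Some true)) (word ts) = count snd ts.
Proof.
elim: ts => //= t ts IH; rewrite /word /= count_cat -/(word ts) IH.
by case: t => [[] []].
Qed.

Definition nohh (a b : option bool) : bool := isSome a || isSome b.

Lemma path_word s ts : path nohh (Some s) (word ts) && isSome (last (Some s) (word ts)).
Proof.
elim: ts s => //= t ts IH s; rewrite /word /= cat_path last_cat -/(word ts).
by case: t => [[] u] /=; exact: IH.
Qed.

(** A hole is never last and is followed by an electron, so one or two letters can be split off as a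
    tile; the induction is on the length. *)
Lemma word_parse s W : path nohh (Some s) W -> isSome (last (Some s) W) ->
  exists ts, word ts = W.
Proof.
have [n] := ubnP (size W); elim: n s W => // n IH s [|[u|] W] /=.
- by move=> _ _ _; exists [::].
- rewrite ltnS => sW pW lW; have [ts <-] := IH u W sW pW lW.
  by exists ((false, u) :: ts).
case: W => [|[u|] W] //= sW pW lW.
have [ts <-] := IH u W (ltn_trans (ltnSn _) sW) pW lW.
by exists ((true, u) :: ts).
Qed.

Lemma sum_nth_count (A : Type) (a0 : A) (P : pred A) (W : seq A) :
  (\sum_(i < size W) P (nth a0 W i) = count P W)%N.
Proof.
rewrite -(big_mkord predT (fun i => nat_of_bool (P (nth a0 W i)))).
by rewrite -(big_nth a0 predT (fun a => nat_of_bool (P a))) -sum1_count [RHS]big_mkcond.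
Qed.

Lemma nth_cat0 (A : Type) (a0 u : A) (W1 W2 : seq A) :
  nth a0 (W1 ++ u :: W2) (size W1) = u.
Proof. by rewrite nth_cat ltnn subnn. Qed.

Lemma nth_cat1 (A : Type) (a0 u v : A) (W1 W2 : seq A) :
  nth a0 (W1 ++ [:: u, v & W2]) (size W1).+1 = v.
Proof. by rewrite -cat_rcons -(size_rcons W1 u) nth_cat0. Qed.

(** * Connectivity of the configurations with a fixed number of up spins *)

Section Connectivity.
Variables (Ns Ne : nat).
Hypothesis Ns_gt0 : (0 < Ns)%N.
Implicit Types (S T : fock Ns) (x y : 'I_Ns) (W : seq (option bool)).

Local Notation osite := (osite Ns_gt0).

(** The number of steps from [z] forward to [x] around the ring. *)
Definition ofs (z : nat) x : nat := (x + (Ns - z %% Ns)) %% Ns.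

Lemma ofs_osite z i : (i < Ns)%N -> ofs z (osite (z + i)) = i.
Proof.
move=> iN; rewrite /ofs /= modnDml {1}(divn_eq z Ns).
have := ltn_pmod z Ns_gt0; set r := (z %% Ns)%N => rN.
have -> : (z %/ Ns * Ns + r + i + (Ns - r) = (z %/ Ns).+1 * Ns + i)%N.
  by rewrite mulSn; lia.
by rewrite modnMDl modn_small.
Qed.

Lemma osite_ofs z x : osite (z + ofs z x) = x.
Proof.
apply: val_inj; rewrite /= /ofs modnDmr {1}(divn_eq z Ns).
have := ltn_pmod z Ns_gt0; set r := (z %% Ns)%N => rN.
have -> : (z %/ Ns * Ns + r + (x + (Ns - r)) = (z %/ Ns).+1 * Ns + x)%N.
  by rewrite mulSn; lia.
by rewrite modnMDl modn_small.
Qed.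

Lemma ofs_lt z x : (ofs z x < Ns)%N.
Proof. exact: ltn_pmod. Qed.

Lemma osite_eq z i j : (i < Ns)%N -> (j < Ns)%N ->
  (osite (z + i) == osite (z + j)) = (i == j).
Proof.
move=> iN jN; apply/eqP/eqP => [|->//].
by move/(congr1 (ofs z)); rewrite !ofs_osite.
Qed.

Lemma sum_osite (F : 'I_Ns -> nat) z :
  (\sum_x F x = \sum_(i < Ns) F (osite (z + i)))%N.
Proof.
rewrite (reindex (fun i : 'I_Ns => osite (z + i))) //; apply: onW_bij.
exists (fun x => Ordinal (ofs_lt z x)) => [i|x] /=; last exact: osite_ofs.
by apply: val_inj; rewrite /= ofs_osite.
Qed.

(** The word [W] written along the ring from site [z], where [z] is any natural number read modulo
    [Ns]. *)
Definition conf z W : fock Ns := [set m | nth None W (ofs z m.1) == Some m.2].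

Lemma conf_in z W i s : (i < Ns)%N ->
  ((osite (z + i), s) \in conf z W) = (nth None W i == Some s).
Proof. by move=> iN; rewrite inE /= ofs_osite. Qed.

Lemma fock_eq z S T :
  (forall i s, (i < Ns)%N -> ((osite (z + i), s) \in S) = ((osite (z + i), s) \in T)) ->
  S = T.
Proof.
move=> ST; apply/setP => -[x s].
by rewrite -(osite_ofs z x); apply: ST; exact: ofs_lt.
Qed.

Lemma conf_period z W : conf (z + Ns) W = conf z W.
Proof. by apply/setP => m; rewrite !inE /ofs modnDr. Qed.

Lemma osite_period k : osite (k + Ns) = osite k.
Proof. by apply: val_inj; rewrite /= modnDr. Qed.

Lemma conf_rot z W1 W2 : size (W1 ++ W2) = Ns ->
  conf z (W1 ++ W2) = conf (z + size W1) (W2 ++ W1).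
Proof.
rewrite size_cat => sW; apply: (@fock_eq z) => i s iN.
rewrite conf_in // nth_cat; case: ltnP => iW.
  have -> : osite (z + i) = osite (z + size W1 + (size W2 + i)).
    by rewrite -osite_period; congr osite; lia.
  rewrite conf_in; last by lia.
  by rewrite nth_cat ltnNge leq_addr /= addKn.
have -> : (z + i = z + size W1 + (i - size W1))%N by lia.
rewrite conf_in; last by lia.
by rewrite nth_cat; case: ltnP => //; lia.
Qed.

Lemma conf_sw z W W' p q : (p < Ns)%N -> (q < Ns)%N ->
  (forall i, nth None W' i
     = nth None W (if i == p then q else if i == q then p else i)) ->
  conf z W' = sw (osite (z + p)) (osite (z + q)) (conf z W).
Proof.
move=> pN qN WW; apply: (@fock_eq z) => i s iN.
rewrite conf_in // WW [RHS]inE /= permE /= !osite_eq //.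
by case: ifP => _; [|case: ifP => _]; rewrite conf_in.
Qed.

Lemma nodbl_conf z W : nodbl (conf z W).
Proof. by apply/forallP => x; rewrite !inE /=; case: nth => [[]|]. Qed.

Lemma occ_conf z W i : (i < Ns)%N -> occ (conf z W) (osite (z + i)) = isSome (nth None W i).
Proof. by move=> iN; rewrite /occ !conf_in //; case: nth => [[]|]. Qed.

Lemma nup_sum S : nup S = (\sum_x ((x, true) \in S))%N.
Proof.
by rewrite /nup -sum1_card [LHS]big_mkcond; apply: eq_bigr => x _; rewrite inE; case: (_ \in S).
Qed.

Lemma nup_conf z W : size W = Ns -> nup (conf z W) = count (pred1 (Some true)) W.
Proof.
move=> sW; rewrite nup_sum (sum_osite _ z) -(sum_nth_count None) sW.
by apply: eq_bigr => i _; rewrite conf_in.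
Qed.

Lemma card_conf z W : size W = Ns -> #|conf z W| = count isSome W.
Proof.
move=> sW; rewrite card_fock (sum_osite _ z) -(sum_nth_count None) sW.
by apply: eq_bigr => i _; rewrite noccE ?nodbl_conf // occ_conf.
Qed.

Hypotheses (evenN : ~~ odd Ns) (Ne_lt : (Ne < Ns)%N) (Ns_lt : (Ns < 2 * Ne)%N).

(** One tile per electron and one marked tile per hole, so that the word fills the ring exactly. *)
Definition valid (ts : seq (bool * bool)) : bool := (size ts == Ne) && (count fst ts == Ns - Ne)%N.

Lemma size_word_valid ts : valid ts -> size (word ts) = Ns.
Proof. by move=> /andP[/eqP s1 /eqP c1]; rewrite size_word s1 c1; lia. Qed.

Lemma allowed_conf z ts : valid ts -> allowed Ne (conf z (word ts)).
Proof.
move=> vt; have sW := size_word_valid vt; have /andP[/eqP sts _] := vt.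
apply/allowedP; first exact: ltnW.
split; [by rewrite card_conf // count_word_isSome | exact: nodbl_conf |].
move=> x; rewrite -(osite_ofs z x) nxt_osite -addnS.
have iN := ofs_lt z x; set i := ofs z x in iN *.
have /andP[pW lW] := path_word true ts.
rewrite occ_conf //; have [i1|i1] := ltnP i.+1 Ns.
  rewrite occ_conf //; move/(pathP None): pW => /(_ i.+1); rewrite sW => /(_ i1).
  by [].
have iE : size (word ts) = i.+1 by lia.
(* At the seam, the last letter of the word is an electron. *)
by move: lW; rewrite (last_nth None) iE /= => ->.
Qed.

Lemma allowed_word S : allowed Ne S ->
  exists z ts, valid ts /\ S = conf z (word ts).
Proof.
move=> /(allowedP _ (ltnW Ns_lt))[cS ndS hS].
have [y yS] : exists y, occ S y.
  apply/existsP; have : (0 < #|pos S|)%N by rewrite -card_pos // cS; lia.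
  by move=> /card_gt0P[y]; rewrite inE => yS; apply/existsP; exists y.
(* Reading starts just after an occupied site, so the last letter read is the electron at [y] and
   the word can be cut into tiles. *)
pose z := y.+1.
pose rd i : option bool := if (osite (z + i), true) \in S then Some true else
  if (osite (z + i), false) \in S then Some false else None.
have rdS i : isSome (rd i) = occ S (osite (z + i)).
  by rewrite /rd /occ; case: ifP => //=; case: ifP.
have rdE i s : (rd i == Some s) = ((osite (z + i), s) \in S).
  rewrite /rd; have := forallP ndS (osite (z + i)).
  by case: s; do 2!case: (_ \in S).
have sR : size (mkseq rd Ns) = Ns by rewrite size_mkseq.
have [ts tsE] : exists ts, word ts = mkseq rd Ns.
  apply: (@word_parse true).
    apply/(pathP None) => -[|i] //; rewrite sR => iN /=.
    rewrite !nth_mkseq //; last exact: ltnW.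
    by rewrite /nohh !rdS addnS -nxt_osite.
  rewrite (last_nth None) sR -(prednK Ns_gt0) /= prednK // nth_mkseq ?ltn_predL //.
  rewrite rdS; have -> : osite (z + Ns.-1) = y; last by [].
  by rewrite -[RHS](osite_val Ns_gt0) -[RHS]osite_period; congr osite; rewrite /z; lia.
have SE : S = conf z (word ts).
  by apply: (@fock_eq z) => i s iN; rewrite conf_in // tsE nth_mkseq // rdE.
exists z, ts; split=> //; have sW : size (word ts) = Ns by rewrite tsE.
have sts : size ts = Ne by rewrite -count_word_isSome -(card_conf z) // -SE.
by rewrite /valid sts eqxx /=; have := size_word ts; rewrite sW sts; lia.
Qed.

Definition adj S T : bool :=
  [&& allowed Ne S, allowed Ne T & [exists b, hopb Ns_gt0 b S T]].

Lemma hops_sym x y S T : hops x y S T = hops x y T S.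
Proof.
have imp A B : hops x y A B -> hops x y B A.
  move=> /andP[o /eqP->]; rewrite /hops swK eqxx andbT !occ_sw tpermL tpermR.
  by rewrite eq_sym.
by apply/idP/idP; exact: imp.
Qed.

Lemma adj_sym : connect_sym adj.
Proof.
apply: sym_connect_sym => S T; rewrite /adj andbCA; congr [&& _, _ & _].
by apply: eq_existsb => b; rewrite /hopb hops_sym.
Qed.

Local Notation h := (Ns - Ne)%N.

(** Electron [a] hops onto the hole at its left: the hole mark passes from [a] to [b], while the
    order of the spins is unchanged. *)
Lemma adj_nn z A B a b : valid (A ++ (true, a) :: (false, b) :: B) ->
  adj (conf z (word (A ++ (true, a) :: (false, b) :: B)))
      (conf z (word (A ++ (false, a) :: (true, b) :: B))).
Proof.
move=> v1; have v2 : valid (A ++ (false, a) :: (true, b) :: B).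
  by move: v1; rewrite /valid !size_cat !count_cat /= addnCA.
apply/and3P; split; [exact: allowed_conf | exact: allowed_conf |].
apply/existsP; exists (inl (osite (z + size (word A)))).
have := size_word_valid v1.
rewrite !word_cat /= !size_cat /= => sW.
rewrite /hopb hops_sym /hops /= nxt_osite -addnS !occ_conf; [|lia|lia].
rewrite /word /= -!/(word _) nth_cat0 nth_cat1 /=.
apply/eqP; apply: conf_sw; [lia | lia |] => i; set p := size (word A).
have [->|ip] := eqVneq i p; first by rewrite nth_cat0 nth_cat1.
have [->|ip1] := eqVneq i p.+1; first by rewrite nth_cat0 nth_cat1.
rewrite !nth_cat -/p; case: ltnP => // pi; have -> : (i - p = (i - p.+2).+2)%N by lia.
by [].
Qed.

(** On sites 1 to 4 the pattern hole, [a], [b], [c] becomes [b], [a], hole, [c]: electron [b] jumps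
    over [a] along the first [t'] bond, between sites 1 and 3. *)
Lemma adj_nnn a b c B : valid [:: (true, a), (false, b), (false, c) & B] ->
  adj (conf 1 (word [:: (true, a), (false, b), (false, c) & B]))
      (conf 1 (word [:: (false, b), (false, a), (true, c) & B])).
Proof.
move=> v1; have v2 : valid [:: (false, b), (false, a), (true, c) & B] by exact: v1.
apply/and3P; split; [exact: allowed_conf | exact: allowed_conf |].
have := size_word_valid v1; rewrite /word /= => sW.
have N2 : (0 < Ns./2)%N by lia.
apply/existsP; exists (inr (Ordinal N2)); rewrite /hopb /bleft /bright !nxt_osite.
rewrite hops_sym /hops.
have -> : osite (2 * Ordinal N2).+1 = osite (1 + 0) by [].
have -> : osite (2 * Ordinal N2).+3 = osite (1 + 2) by [].
rewrite !occ_conf //=; last by lia.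
apply/eqP; apply: conf_sw; [lia | lia |] => i.
by case: i => [|[|[|i]]].
Qed.

(** Separates the hole marks [ms] from the spin sequence [w], which are moved independently. *)
Definition cls z ms w := conf z (word (zip ms w)).

Lemma valid_zip ms w : size ms = Ne -> size w = Ne -> count id ms = h ->
  valid (zip ms w).
Proof.
move=> sm sw cm; rewrite /valid size_zip sm sw minnn eqxx /=.
have -> : count fst (zip ms w) = count id (unzip1 (zip ms w)) by rewrite count_map.
by rewrite unzip1_zip ?cm // sm sw.
Qed.

Lemma connect_marks z w ms ms' : size w = Ne ->
  size ms = Ne -> count id ms = h -> size ms' = Ne -> count id ms' = h ->
  connect adj (cls z ms w) (cls z ms' w).
Proof.
move=> sw; apply: (connect_bubble (F := fun ms => cls z ms w) adj_sym) => A B sAB cAB.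
apply: connect1; rewrite /cls.
have [w1 [w2 [wE sw1]]] : exists w1 w2, w = w1 ++ w2 /\ size w1 = size A.
  exists (take (size A) w), (drop (size A) w); rewrite cat_take_drop size_take sw.
  by split=> //; move: sAB; rewrite size_cat /=; case: ltnP => //; lia.
move: sAB (sAB); rewrite {1}size_cat -sw wE size_cat sw1 => /addnI.
case: w2 wE => [|a [|b w2]] //= wE _ sAB.
have zE ms1 : zip (A ++ ms1) (w1 ++ [:: a, b & w2]) = zip A w1 ++ zip ms1 [:: a, b & w2].
  by rewrite zip_cat.
rewrite !zE /=; apply: adj_nn.
have := @valid_zip (A ++ [:: true, false & B]) w; rewrite wE zE; apply=> //.
- by rewrite sAB -sw wE size_cat /= sw1.
- by rewrite -sw wE.
Qed.

Definition can := nseq h true ++ nseq (Ne - h) false.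

Lemma size_can : size can = Ne.
Proof. by rewrite size_cat !size_nseq; lia. Qed.

Lemma count_can : count id can = h.
Proof. by rewrite count_cat !count_nseq /=; lia. Qed.

(** Both kinds of tile occur, so the marks can be rearranged to put kind [m] first; reading from
    behind that tile then rotates the spin sequence by one. *)
Lemma connect_roll m z a w : size (a :: w) = Ne ->
  connect adj (cls z can (a :: w)) (cls (z + size (tile (m, a))) can (rcons w a)).
Proof.
move=> sw; pose ms := nseq (h - m) true ++ nseq (Ne - h - ~~ m) false.
have sms : size (m :: ms) = Ne by rewrite /= size_cat !size_nseq; case: (m) => /=; lia.
have cms : count id (m :: ms) = h.
  by rewrite /= count_cat !count_nseq /=; case: (m) => /=; lia.
apply: (@connect_trans _ _ (cls z (m :: ms) (a :: w))).
  by apply: connect_marks => //; [exact: size_can | exact: count_can].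
have -> : cls z (m :: ms) (a :: w) = cls (z + size (tile (m, a))) (rcons ms m) (rcons w a).
  rewrite /cls; have sE : size ms = size w by move: sms; rewrite -sw => -[].
  have sW := size_word_valid (valid_zip sms sw cms).
  have ->: word (zip (m :: ms) (a :: w)) = tile (m, a) ++ word (zip ms w) by [].
  rewrite conf_rot //.
  by rewrite -!cats1 zip_cat // word_cat [zip [:: _] _]/= word_cons cats0.
apply: connect_marks; rewrite ?size_can ?count_can ?size_rcons //.
by rewrite -cats1 count_cat addnC /= addn0 -cms.
Qed.

(* Rolling once past a lone electron and once past a hole-electron tile gives the
   same electron sequence read from two consecutive sites. *)
Lemma connect_shift z w : size w = Ne -> connect adj (cls 1 can w) (cls z.+1 can w).
Proof.
move=> sw; elim: z => [|z IH]; first exact: connect0.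
apply: (connect_trans IH).
case/lastP: w sw {IH} => [|w a]; first by move=> /= ?; lia.
rewrite size_rcons => sw.
have c1 := @connect_roll false z a w sw; have c2 := @connect_roll true z a w sw.
move: c1 c2; rewrite /= addn1 addn2 adj_sym => c1 c2.
exact: connect_trans c1 c2.
Qed.

Lemma connect_shift1 z w : size w = Ne -> connect adj (cls z can w) (cls 1 can w).
Proof.
(* Adding a full period turns the start [z], possibly 0, into a successor. *)
move=> sw; rewrite adj_sym; have -> : cls z can w = cls (z + Ns).-1.+1 can w.
  by rewrite prednK ?addn_gt0 ?Ns_gt0 ?orbT // /cls conf_period.
exact: connect_shift.
Qed.

(** Roll past a lone electron, then bring the starting site back to 1. *)
Lemma connect_rot1 a w : size (a :: w) = Ne ->
  connect adj (cls 1 can (a :: w)) (cls 1 can (rcons w a)).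
Proof.
move=> sw; apply: connect_trans (@connect_roll false 1 a w sw) _.
by apply: connect_shift1; rewrite size_rcons.
Qed.

Lemma connect_rot w1 w2 : size (w1 ++ w2) = Ne ->
  connect adj (cls 1 can (w1 ++ w2)) (cls 1 can (w2 ++ w1)).
Proof.
elim: w1 w2 => [|a w1 IH] w2 /=; first by rewrite cats0 => _; exact: connect0.
move=> sw; apply: (connect_trans (connect_rot1 sw)).
rewrite rcons_cat -cat_rcons; apply: IH.
by move: sw; rewrite !size_cat size_rcons; lia.
Qed.

Lemma connect_swap a b w : (size w).+2 = Ne ->
  connect adj (cls 1 can [:: a, b & w]) (cls 1 can [:: b, a & w]).
Proof.
(* Two electrons alone would force [Ns = 3], which is odd. *)
case: w => [|c w] sw; first by move: sw evenN => /=; lia.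
pose ms := nseq h.-1 true ++ nseq (Ne - h - 2) false.
(* There are [2 * Ne - Ns] unmarked tiles, a positive even number, so the marks can begin with
   [true, false, false] as [adj_nnn] requires. *)
have hh : (Ne - h >= 2)%N by move: evenN; lia.
have sms : size [:: true, false, false & ms] = Ne.
  by rewrite /= size_cat !size_nseq; lia.
have cms : count id [:: true, false, false & ms] = h.
  by rewrite /= count_cat !count_nseq /=; lia.
have sms' : size [:: false, false, true & ms] = Ne by exact: sms.
have cms' : count id [:: false, false, true & ms] = h by exact: cms.
apply: (@connect_trans _ _ (cls 1 [:: true, false, false & ms] [:: a, b, c & w])).
  by apply: connect_marks; rewrite ?size_can ?count_can.
apply: (@connect_trans _ _ (cls 1 [:: false, false, true & ms] [:: b, a, c & w])).
  apply: connect1; rewrite /cls /=; apply: adj_nnn.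
  exact: (@valid_zip [:: true, false, false & ms] [:: a, b, c & w]).
by apply: connect_marks; rewrite ?size_can ?count_can.
Qed.

(** Any adjacent transposition is obtained by rotating the pair to the front, swapping it there and
    rotating back. *)
Lemma connect_spins w w' : size w = Ne -> size w' = Ne ->
  count id w = count id w' -> connect adj (cls 1 can w) (cls 1 can w').
Proof.
move=> sw sw' cw; apply: (connect_bubble (F := cls 1 can) (n := Ne) (k := count id w') adj_sym) => //.
move=> A B sAB _; apply: (connect_trans (connect_rot sAB)).
move: sAB; rewrite size_cat /= => sAB.
apply: (@connect_trans _ _ (cls 1 can ([:: false, true & B] ++ A))).
  by apply: connect_swap; rewrite size_cat; lia.
by apply: connect_rot; rewrite size_cat /=; lia.
Qed.

Lemma allowed_connect S T : allowed Ne S -> allowed Ne T -> nup S = nup T ->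
  connect adj S T.
Proof.
have toC R : allowed Ne R -> exists w,
    [/\ size w = Ne, count id w = nup R & connect adj R (cls 1 can w)].
  move=> /allowed_word[z [ts [vt ->]]]; have /andP[/eqP st /eqP ct] := vt.
  exists (unzip2 ts); split; first by rewrite size_map.
    by rewrite nup_conf ?size_word_valid // count_word_up count_map.
  have -> : conf z (word ts) = cls z (unzip1 ts) (unzip2 ts) by rewrite /cls zip_unzip.
  apply: (@connect_trans _ _ (cls z can (unzip2 ts))).
    by apply: connect_marks; rewrite ?size_can ?count_can ?size_map // count_map.
  by apply: connect_shift1; rewrite size_map.
move=> /toC[w [sw cw Sw]] /toC[w' [sw' cw' Tw']] ST.
apply: (connect_trans Sw); rewrite adj_sym; apply: (connect_trans Tw').
by apply: connect_spins => //; rewrite cw cw'.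
Qed.

Lemma allowed_exists : exists S, allowed Ne S.
Proof.
exists (cls 1 can (nseq Ne true)); apply: allowed_conf.
by apply: valid_zip; rewrite ?size_can ?size_nseq ?count_can.
Qed.

End Connectivity.

(** * Total spin of states that are symmetric in the spins *)

Section Spin.
Variables (C : numClosedFieldType) (Ns Ne : nat).
Hypothesis Ns_le : (Ns <= 2 * Ne)%N.
Implicit Types (S T : fock Ns) (x y z : 'I_Ns).

Definition flip x s u T : fock Ns := (x, s) |: (T :\ (x, u)).

Lemma flip_notin T x s u : nodbl T -> (x, u) \in T -> (x, s) \notin T :\ (x, u).
Proof.
move=> ndT xT; rewrite !inE xpair_eqE eqxx /=.
have [->//|su] := eqVneq s u; have -> : s = ~~ u by case: (s) (u) su => [] [].
by rewrite /= nodblN.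
Qed.

Lemma flipK T x s u : nodbl T -> (x, u) \in T -> flip x u s (flip x s u T) = T.
Proof.
move=> ndT xT; rewrite /flip setU1K ?setD1K //; exact: flip_notin.
Qed.

Lemma flip_in T x s u : (x, s) \in flip x s u T.
Proof. by rewrite !inE eqxx. Qed.

Lemma in_flip T x s u z w : nodbl T -> (x, u) \in T ->
  ((z, w) \in flip x s u T) = if z == x then w == s else (z, w) \in T.
Proof.
move=> ndT xT; rewrite /flip in_setU1 xpair_eqE; case: eqP => [->|zx] /=; last first.
  by rewrite !inE xpair_eqE; case: eqP zx.
case: (eqVneq w s) => //= ws; apply/negbTE; exact: flip_notin.
Qed.

Lemma occ_flip T x s u : nodbl T -> (x, u) \in T -> occ (flip x s u T) =1 occ T.
Proof.
move=> ndT xT z; rewrite /occ !in_flip //; case: eqP => // ->.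
by move: (occ_in xT); rewrite /occ => ->; case: (s).
Qed.

Lemma pos_flip T x s u : nodbl T -> (x, u) \in T -> pos (flip x s u T) = pos T.
Proof. by move=> ndT xT; apply/setP => z; rewrite !inE occ_flip. Qed.

Lemma nodbl_flip T x s u : nodbl T -> (x, u) \in T -> nodbl (flip x s u T).
Proof.
move=> ndT xT; apply/forallP => z; rewrite !in_flip //; case: eqP => _.
  by case: (s).
exact: (forallP ndT).
Qed.

Lemma allowed_flip T x s u : allowed Ne T -> (x, u) \in T -> allowed Ne (flip x s u T).
Proof.
move=> /(allowedP _ Ns_le)[cT ndT hT] xT; apply/allowedP => //; split.
- by rewrite card_pos ?nodbl_flip // pos_flip // -card_pos.
- exact: nodbl_flip.
- by move=> z; rewrite !occ_flip.
Qed.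

Lemma nup_flip T x s u : nodbl T -> (x, u) \in T ->
  (nup (flip x s u T) + u = nup T + s)%N.
Proof.
move=> ndT xT; rewrite !nup_sum (bigD1 x) //= [in RHS](bigD1 x) //=.
rewrite in_flip // eqxx.
rewrite [in LHS](eq_bigr (fun z => nat_of_bool ((z, true) \in T))); last first.
  by move=> z /negPf zx; rewrite in_flip // zx.
have -> : (x, true) \in T = u.
  by move: (nodblN ndT xT) (xT); case: (u) => [_ ->|/negbTE ->].
by case: (s); case: (u) => /=; lia.
Qed.

(** No sign appears: the two modes of a site are neighbours in the Jordan-Wigner order, so every
    other electron contributes the same factor twice. *)
Lemma he_spin S T x s u : nodbl T ->
  he C (x, s) (x, u) S T = (((x, u) \in T) && (S == flip x s u T))%:R.
Proof.
move=> ndT; rewrite /he; case: (boolP ((x, u) \in T)) => //= xT.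
rewrite flip_notin //= -/(flip x s u T); case: eqP => // _.
rewrite jwsignE jwsignD1 -big_split big1 // => -[z w] zT /=.
have [->|zx'] := altP ((z, w) =P (x, u)); first by rewrite ltnn mulr1.
have zx : z != x.
  apply: contraNneq zx' => zx; rewrite zx in zT *.
  have := nodblN ndT xT; case: (eqVneq w u) => [->//|wu].
  have uw : ~~ u = w by case: (u) (w) wu => [] [].
  by rewrite uw zT.
have -> : (midx (z, w) < midx (x, u))%N = (midx (z, w) < midx (x, s))%N.
  by move: zx; rewrite -val_eqE /midx /=; case: (s); case: (u); case: (w) => /=; lia.
by rewrite /= -expr2 sqrr_sign.
Qed.

(** Amplitudes that depend only on the occupied sites and the number of up spins, hence are
    invariant under permuting the spins. *)
Definition symamp (v : 'cV[C]_(dimF Ns)) (G : {set 'I_Ns} -> nat -> C) : Prop :=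
  forall S, amp v S = if allowed Ne S then G (pos S) (nup S) else 0.

(** Only [flip x u s S] contributes. The subtraction is genuine: if [s] is up, then [S] has an up
    spin at [x]. *)
Lemma sum_he_spin v G S x s u : symamp v G ->
  \sum_T he C (x, s) (x, u) S T * amp v T
    = if allowed Ne S && ((x, s) \in S) then G (pos S) (nup S + u - s)%N else 0.
Proof.
move=> vG.
have T0 T : he C (x, s) (x, u) S T * amp v T
    = if [&& allowed Ne T, (x, u) \in T & S == flip x s u T]
      then G (pos T) (nup T) else 0.
  rewrite vG; case: (boolP (allowed Ne T)) => aT; last by rewrite mulr0.
  have [_ ndT _] := allowedP _ Ns_le aT; rewrite he_spin //=.
  by case: ifP; rewrite ?mul1r ?mul0r.
have [/andP[aS xS]|nS] := boolP (_ && _).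
  have [_ ndS _] := allowedP _ Ns_le aS.
  rewrite (bigD1 (flip x u s S)) //= big1 ?addr0 => [|T TS].
    rewrite T0 allowed_flip // flip_in flipK // eqxx /= pos_flip //.
    have := nup_flip u ndS xS => nS.
    by congr (G _ _); lia.
  rewrite T0; case: ifP => // /and3P[aT xT /eqP SE].
  have [_ ndT _] := allowedP _ Ns_le aT.
  by move: TS; rewrite SE flipK // eqxx.
rewrite big1 // => T _; rewrite T0; case: ifP => // /and3P[aT xT /eqP SE].
by move: nS; rewrite SE allowed_flip // flip_in.
Qed.

(** A spin component acting on [G], with one term per up electron ([k] of them) and per down
    electron ([Ne - k]). The truncated [k.-1] at [k = 0] is multiplied by zero. *)
Definition spinop (a : 'I_3) (G : {set 'I_Ns} -> nat -> C) X k : C :=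
  2%:R^-1 * (k%:R * (pauli C a true true * G X k + pauli C a true false * G X k.-1)
    + (Ne%:R - k%:R) * (pauli C a false true * G X k.+1 + pauli C a false false * G X k)).

Lemma symamp_Stot a v G : symamp v G -> symamp (Stot C Ns a *m v) (spinop a G).
Proof.
move=> vG S.
have -> : Stot C Ns a = opmx (fun S T => 2%:R^-1 * \sum_x \sum_(s : bool) \sum_(u : bool)
    pauli C a s u * he C (x, s) (x, u) S T).
  rewrite -opmxZ -opmx_sum; congr (_ *: _); apply: eq_bigr => x _.
  rewrite -opmx_sum; apply: eq_bigr => s _; rewrite -opmx_sum; apply: eq_bigr => u _.
  by rewrite -opmxZ ccre_cann.
rewrite amp_opmx.
have -> : \sum_T (2%:R^-1 * \sum_x \sum_(s : bool) \sum_(u : bool)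
      pauli C a s u * he C (x, s) (x, u) S T) * amp v T
    = 2%:R^-1 * \sum_x \sum_(s : bool) \sum_(u : bool)
      pauli C a s u * \sum_T he C (x, s) (x, u) S T * amp v T.
  under eq_bigr do rewrite -mulrA mulr_suml.
  rewrite -mulr_sumr exchange_big; congr (_ * _); apply: eq_bigr => x _.
  under eq_bigr do rewrite mulr_suml.
  rewrite exchange_big; apply: eq_bigr => s _.
  under eq_bigr do rewrite mulr_suml.
  rewrite exchange_big; apply: eq_bigr => u _.
  by rewrite mulr_sumr; apply: eq_bigr => T _; rewrite mulrA.
under eq_bigr => x _ do under eq_bigr => s _ do
  under eq_bigr => u _ do rewrite (sum_he_spin S x s u vG).
case: (boolP (allowed Ne S)) => aS /=; last first.
  rewrite big1 ?mulr0 // => x _; rewrite big1 // => s _; rewrite big1 // => u _.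
  by rewrite mulr0.
have [cS ndS _] := allowedP _ Ns_le aS.
rewrite /spinop; congr (_ * _).
set X := pos S; set k := nup S.
have kE : k%:R = \sum_x ((x, true) \in S)%:R :> C by rewrite /k nup_sum natr_sum.
have dE : Ne%:R - k%:R = \sum_x ((x, false) \in S)%:R :> C.
  rewrite kE -cS card_fock natr_sum -sumrB; apply: eq_bigr => x _.
  by rewrite /nocc natrD addrC addKr.
rewrite dE {1}kE !mulr_suml -big_split /=; apply: eq_bigr => x _.
rewrite !big_bool.
have -> : (k + true - true = k)%N by rewrite addnK.
have -> : (k + false - true = k.-1)%N by rewrite addn0 subn1.
have -> : (k + true - false = k.+1)%N by rewrite addn1.
have -> : (k + false - false = k)%N by rewrite addn0 subn0.
by rewrite /=; case: ((x, true) \in S); case: ((x, false) \in S); rewrite ?mulr0 ?mul1r ?mul0r ?addr0 ?add0r.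
Qed.

Lemma spinop_sq (G : {set 'I_Ns} -> nat -> C) X k :
  \sum_(a < 3) spinop a (spinop a G) X k
    = (Ne%:R / 2%:R) * (Ne%:R / 2%:R + 1) * G X k.
Proof.
rewrite !big_ord_recl big_ord0 /spinop /pauli /=.
have I2 : 'i * 'i = -1 :> C by rewrite -expr2 sqrCi.
have h2 : 2%:R * 2%:R^-1 = 1 :> C by rewrite mulfV ?pnatr_eq0.
move: (2%:R^-1 : C) h2 => h h2.
(* The case [k = 0] is separate because of the truncated predecessor. *)
case: k => [|k] /=; first by ring: I2 h2.
by rewrite -(natr1 k.+1) -(natr1 k); ring: I2 h2.
Qed.

Lemma symamp_Ssq v G : symamp v G ->
  Ssq C Ns *m v = ((Ne%:R / 2%:R) * (Ne%:R / 2%:R + 1)) *: v.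
Proof.
move=> vG; apply: amp_inj => S.
have -> : amp (Ssq C Ns *m v) S = \sum_(a < 3) amp (Stot C Ns a *m (Stot C Ns a *m v)) S.
  by rewrite /amp /Ssq mulmx_suml summxE; apply: eq_bigr => a _; rewrite mulmxA.
rewrite ampZ vG; case: ifP => aS.
  rewrite -spinop_sq; apply: eq_bigr => a _.
  by rewrite (symamp_Stot a (symamp_Stot a vG)) aS.
rewrite mulr0 big1 // => a _.
by rewrite (symamp_Stot a (symamp_Stot a vG)) aS.
Qed.

End Spin.

(** * Uniqueness in each spin sector and the ground-state multiplet *)

Section GroundStates.
Variables (C : numClosedFieldType) (Ns Ne : nat) (t t' : C).
Hypothesis Ns_gt0 : (0 < Ns)%N.
Hypotheses (evenN : ~~ odd Ns) (oddNe : odd Ne).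
Hypotheses (Ne_lt : (Ne < Ns)%N) (Ns_lt : (Ns < 2 * Ne)%N).
Hypotheses (t_gt0 : 0 < t) (t'_gt0 : 0 < t').
Implicit Types (S T : fock Ns) (X : {set 'I_Ns}).

Local Notation Ns_le := (ltnW Ns_lt).
Local Notation A := (hopmx Ns_gt0 t t').
Local Notation bl := (bleft Ns_gt0).
Local Notation br := (bright Ns_gt0).
Local Notation swb b S := (sw (bl b) (br b) S).
Local Notation eigen f E := (eigenfun (@allowed Ns Ne) A f E).

Lemma bweight_gt0 b : 0 < @bweight C Ns t t' b.
Proof. by case: b. Qed.

Lemma hopmx_sym S T : A S T = A T S.
Proof. by congr (- _); apply: eq_bigr => b _; rewrite /hopb hops_sym. Qed.

Lemma hopmx_le0 S T : A S T <= 0.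
Proof.
by rewrite oppr_le0 sumr_ge0 // => b _; rewrite mulr_ge0 ?ler0n ?ltW ?bweight_gt0.
Qed.

Lemma hopmx_adj S T : adj Ne Ns_gt0 S T -> A S T != 0.
Proof.
move=> /and3P[_ _ /existsP[b hb]]; rewrite oppr_eq0 (bigD1 b) //= hb mulr1.
rewrite gt_eqF // ltr_pwDl ?bweight_gt0 // sumr_ge0 // => c _.
by rewrite mulr_ge0 ?ler0n ?ltW ?bweight_gt0.
Qed.

(** The zeros of [f] are closed under hops with non-zero amplitude, and these connect the whole
    sector. *)
Lemma eigen_zero f E S T : eigen f E -> (forall R, 0 <= f R) ->
  allowed Ne S -> allowed Ne T -> nup S = nup T -> f S = 0 -> f T = 0.
Proof.
move=> ef f0 aS aT ST fS.
pose Z := [pred R | allowed Ne R && (f R == 0)].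
have Zc : closed (adj Ne Ns_gt0) Z.
  apply: intro_closed; first exact: adj_sym.
  move=> P Q PQ /andP[aP /eqP fP]; have /and3P[_ aQ _] := PQ.
  rewrite inE aQ; apply/eqP.
  by apply: (eigenfun_zero _ f0 ef aP aQ (hopmx_adj PQ) fP) => ? ? _ _; exact: hopmx_le0.
have := closed_connect Zc (allowed_connect Ns_gt0 evenN Ne_lt Ns_lt aS aT ST).
by rewrite !inE aS aT fS eqxx /= => /esym/eqP.
Qed.

Definition movable b S : bool := (occ S (bl b) != occ S (br b)) && allowed Ne (swb b S).

Lemma hop_sum f S : \sum_(T in @allowed Ns Ne) A S T * f T
  = - \sum_b bweight t t' b * (if movable b S then f (swb b S) else 0).
Proof.
under eq_bigr do rewrite mulNr mulr_suml.
rewrite sumrN exchange_big /=; congr (- _); apply: eq_bigr => b _.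
under eq_bigr do rewrite -mulrA.
rewrite -mulr_sumr; congr (_ * _); rewrite /movable.
have hE T : hopb Ns_gt0 b S T = (occ S (bl b) != occ S (br b)) && (T == swb b S).
  by rewrite /hopb hops_sym.
under eq_bigr do rewrite hE.
case: (_ != _) => /=; last by rewrite big1 // => T _; rewrite mul0r.
rewrite big_mkcond (bigD1 (swb b S)) //= big1 ?addr0 => [|T /negPf->].
  by rewrite eqxx mul1r.
by rewrite mul0r if_same.
Qed.

Lemma allowed_pos S T : nodbl S -> nodbl T -> pos S = pos T ->
  allowed Ne S -> allowed Ne T.
Proof.
move=> ndS ndT ST /(allowedP _ Ns_le)[cS _ hS].
have oE x : occ T x = occ S x by move/setP: ST => /(_ x); rewrite !inE.
apply/allowedP; first exact: Ns_le.
by split=> // [|x]; rewrite ?oE ?hS // card_pos // -ST -card_pos.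
Qed.

Lemma movable_pos b S T : allowed Ne S -> allowed Ne T -> pos S = pos T ->
  movable b S -> movable b T.
Proof.
move=> /(allowedP _ Ns_le)[_ ndS _] /(allowedP _ Ns_le)[_ ndT _] ST /andP[o aS].
have oE x : occ T x = occ S x by move/setP: ST => /(_ x); rewrite !inE.
apply/andP; split; first by rewrite !oE.
by apply: allowed_pos aS; rewrite ?nodbl_sw // !pos_sw ST.
Qed.

Definition fibersum (f : fock Ns -> C) X : C :=
  \sum_(S | allowed Ne S && (pos S == X)) f S.

(** Exchanging the ends of [b] is a bijection between the spin arrangements over [pos S] and those
    over the new positions. *)
Lemma fibersum_sw f b S : allowed Ne S -> movable b S ->
  \sum_(T | allowed Ne T && (pos T == pos S)) f (swb b T)
    = fibersum f (pos (swb b S)).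
Proof.
move=> aS mS; rewrite /fibersum [RHS](reindex_inj (can_inj (@swK _ (bl b) (br b)))) /=.
apply: eq_bigl => T; rewrite !pos_sw.
have pK : injective (fun Y : {set 'I_Ns} => tperm (bl b) (br b) @^-1: Y).
  by apply: (can_inj (g := fun Y : {set 'I_Ns} => tperm (bl b) (br b) @^-1: Y)) => Y;
    apply/setP => z; rewrite !inE tpermK.
rewrite (inj_eq pK); case: eqP => [TS|]; rewrite ?andbF ?andbT //.
have [_ ndS _] := allowedP _ Ns_le aS; have /andP[_ aS'] := mS.
apply/idP/idP => aT.
  by have /andP[] := movable_pos aS aT (esym TS) mS.
have [_] := allowedP _ Ns_le aT; rewrite nodbl_sw => ndT _.
exact: allowed_pos aS.
Qed.

(* The hopping amplitudes do not depend on the spins, so summing an eigenvector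
   over all spin arrangements gives an eigenvector of the spinless problem, which
   lifts back to every spin sector. *)
Lemma eigen_fibersum f E (c : nat -> C) : eigen f E ->
  eigen (fun S => c (nup S) * fibersum f (pos S)) E.
Proof.
move=> ef S aS; rewrite hop_sum mulrCA.
have -> : E * fibersum f (pos S)
   = - \sum_b bweight t t' b * (if movable b S then fibersum f (pos (swb b S)) else 0).
  rewrite /fibersum mulr_sumr.
  transitivity (\sum_(T | allowed Ne T && (pos T == pos S))
    - \sum_b bweight t t' b * (if movable b S then f (swb b T) else 0)).
    apply: eq_bigr => T /andP[aT /eqP TS]; rewrite -(ef T aT) hop_sum.
    congr (- _); apply: eq_bigr => b _; congr (_ * _).
    have -> // : movable b T = movable b S.
    by apply/idP/idP; apply: movable_pos.
  rewrite sumrN exchange_big /=; congr (- _); apply: eq_bigr => b _.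
  rewrite -mulr_sumr; congr (_ * _); case: ifP => mS; last by rewrite big1.
  exact: fibersum_sw.
rewrite mulrN mulr_sumr; congr (- _); apply: eq_bigr => b _.
by rewrite mulrCA; congr (_ * _); case: ifP; rewrite ?mulr0 // nup_sw.
Qed.

Lemma exists_spins S j : allowed Ne S -> (j <= Ne)%N ->
  exists T, [/\ allowed Ne T, pos T = pos S & nup T = j].
Proof.
move=> aS jN; have [cS ndS _] := allowedP _ Ns_le aS.
pose U := [set x in take j (enum (pos S))].
have UX : U \subset pos S.
  by apply/subsetP => x; rewrite inE => /mem_take; rewrite mem_enum.
have cU : #|U| = j.
  rewrite cardsE (card_uniqP _) ?take_uniq ?enum_uniq // size_take -cardE -card_pos // cS.
  by case: ltnP => //; lia.
pose T : fock Ns := [set m | (m.1 \in pos S) && (m.2 == (m.1 \in U))].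
have inT x s : ((x, s) \in T) = (x \in pos S) && (s == (x \in U)) by rewrite inE.
have ndT : nodbl T.
  by apply/forallP => x; rewrite !inT; case: (x \in U); rewrite /= ?andbF.
have pT : pos T = pos S.
  apply/setP => x; rewrite inE /occ !inT -andb_orr.
  by case: (x \in U); rewrite /= ?andbT.
exists T; split=> //; first by apply: allowed_pos aS.
rewrite -cU; apply: eq_card => x; rewrite [LHS]inE inT eq_sym eqb_id.
by apply/andb_idl => /(subsetP UX).
Qed.

Lemma nup_le S : allowed Ne S -> (nup S <= Ne)%N.
Proof.
move=> /(allowedP _ Ns_le)[<- ndS _]; rewrite card_pos //; apply/subset_leq_card.
by apply/subsetP => x; rewrite !inE /occ => ->.
Qed.

Lemma ground_states : exists E0 : C,
  [/\ is_ground_energy Ns Ne t t' E0,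
      subspace_dim (@ground_state C Ns Ne t t' E0) Ne.+1 &
      forall v : 'cV[C]_(dimF Ns), ground_state Ne t t' E0 v ->
        Ssq C Ns *m v = ((Ne%:R / 2%:R) * (Ne%:R / 2%:R + 1)) *: v].
Proof.
have Ns_gt2 : (2 < Ns)%N by move: evenN oddNe; lia.
have gsP E v := ground_stateP Ns_gt0 evenN oddNe Ns_le Ns_gt2 t t' E v.
have [S1 aS1] := allowed_exists Ns_gt0 evenN Ne_lt Ns_lt.
have [E [[f0 [S0 aS0 f0S] ef0] Emin Eabs]] := @nonpos_min_eigenvalue C _
  (@allowed Ns Ne) A (ex_intro _ S1 aS1)
  (fun S T _ _ => hopmx_sym S T) (fun S T _ _ => hopmx_le0 S T).
pose f S := `|f0 S|; have ef : eigen f E := Eabs _ ef0.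
pose g := fibersum f.
have g_ge0 X : 0 <= g X by rewrite sumr_ge0 // => S _; exact: normr_ge0.
have ec c : eigen (fun S => c (nup S) * g (pos S)) E by exact: eigen_fibersum.
(* If [g] vanished at the positions of [S], the lift of [g] would vanish on the sector of [S0], in
   particular at [S0]; but [g (pos S0)] contains the non-zero term [f S0]. *)
have gN0 S : allowed Ne S -> g (pos S) != 0.
  move=> aS; have [T [aT pT nT]] := exists_spins aS (nup_le aS0).
  apply/negP => /eqP g0.
  have : 1 * g (pos S0) = 0.
    apply: (eigen_zero (ec (fun=> 1)) _ aT aS0 nT); last by rewrite mul1r pT.
    by move=> R; rewrite mul1r.
  rewrite mul1r /g /fibersum => /psumr_eq0P s0.
  have aS0' : allowed Ne S0 by exact: aS0.
  have /(_ S0) := s0 (fun R _ => normr_ge0 _).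
  by rewrite aS0' eqxx => /(_ isT)/eqP; rewrite normr_eq0 (negPf f0S).
(* One reference configuration [Sk k] in each sector. *)
have /fin_all_exists[Sk Skp] : forall k : 'I_Ne.+1,
    exists S, allowed Ne S /\ nup S = k.
  move=> k; have kN : (k <= Ne)%N by rewrite -ltnS.
  by have [T [aT _ nT]] := exists_spins aS1 kN; exists T.
have ordS S (aS : allowed Ne S) : (nup S < Ne.+1)%N := nup_le aS.
(* The coefficient [c k] matches [v] with [g] at the reference configuration. The difference [w] and
   then its modulus are ground states vanishing there, so [w] vanishes on the sector. *)
have expand v : ground_state Ne t t' E v ->
    exists c : nat -> C, symamp Ne v (fun X k => c k * g X).
  move=> /gsP[v0 ev].
  pose c k := amp v (Sk (inord k)) / g (pos (Sk (inord k))); exists c => S.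
  case: (boolP (allowed Ne S)) => [aS|/v0//].
  pose w R := amp v R - c (nup R) * g (pos R).
  have ew : eigen w E.
    move=> R aR; rewrite /w mulrBr -(ev R aR) -(ec c R aR) -sumrB.
    by apply: eq_bigr => T _; rewrite mulrBr.
  have [ak nk] := Skp (Ordinal (ordS S aS)).
  have := eigen_zero (Eabs _ ew) (fun R => normr_ge0 _) ak aS nk.
  have kE : inord (nup S) = Ordinal (ordS S aS) by apply: val_inj; rewrite /= inordK ?ordS.
  rewrite /w nk /c /= kE divfK ?gN0 // subrr normr0 => /(_ erefl)/eqP.
  by rewrite normr_eq0 subr_eq0 => /eqP.
have gsc (c : nat -> C) v : symamp Ne v (fun X k => c k * g X) ->
    ground_state Ne t t' E v.
  move=> vc; apply/gsP; split=> [S /negPf aS|S aS]; first by rewrite vc aS.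
  have aS' : allowed Ne S by exact: aS.
  rewrite vc aS' -(ec c S aS); apply: eq_bigr => T aT.
  by have aT' : allowed Ne T := aT; rewrite vc aT'.
exists E; split.
- split.
    pose v := vec_of (fun S => if allowed Ne S then 1 * g (pos S) else 0).
    have /gsc gv : symamp Ne v (fun X k => 1 * g X) by move=> S; rewrite amp_vec_of.
    case: gv => Pv Hv; exists v; split=> //.
    apply/eqP => v0; have := amp_vec_of (fun S => if allowed Ne S then 1 * g (pos S) else 0) S1.
    by rewrite -/v v0 /amp mxE aS1 mul1r => /esym/eqP; rewrite (negPf (gN0 _ aS1)).
  move=> l [v [vN0 Pv Hv]]; have /gsP[v0 ev] : ground_state Ne t t' l v by split.
  apply: (Emin l (amp v)) ev.
  have [S vS] : exists S, amp v S != 0.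
    apply/existsP; apply: contraNT vN0; rewrite negb_exists => /forallP vz.
    by apply/eqP/amp_inj => S; rewrite {2}/amp mxE; apply/eqP; exact: negbNE (vz S).
  by exists S => //; apply: contraNT vS => /v0->.
(* The basis consists of the lifts of [g] to the single sectors, for 0 to [Ne] up spins. *)
- pose psi k S : C := if allowed Ne S then (nup S == k)%:R * g (pos S) else 0.
  pose B : 'M[C]_(Ne.+1, dimF Ns) := \matrix_(k, i) psi k (enum_val i).
  have psiSk (k l : 'I_Ne.+1) : psi k (Sk l) = (l == k)%:R * g (pos (Sk l)).
    by have [al nl] := Skp l; rewrite /psi al nl -val_eqE.
  have comb (u : 'rV[C]_Ne.+1) v : v^T = u *m B <->
      symamp Ne v (fun X k => u 0 (inord k) * g X).
    have uB S : (u *m B) 0 (enum_rank S)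
        = if allowed Ne S then u 0 (inord (nup S)) * g (pos S) else 0.
      rewrite mxE; case: ifP => aS; last first.
        by rewrite big1 // => k _; rewrite mxE enum_rankK /psi aS mulr0.
      rewrite (bigD1 (inord (nup S))) //= big1 => [|k kS].
        by rewrite mxE enum_rankK /psi aS inordK ?ordS // eqxx mul1r addr0.
      rewrite mxE enum_rankK /psi aS; case: (nup S =P k) kS => [->|_ _]; last by rewrite mul0r mulr0.
      by rewrite inord_val eqxx.
    split=> [vu S|vu]; first by rewrite -uB -vu mxE.
    apply/matrixP => i j; rewrite ord1 mxE.
    by have := vu (enum_val j); rewrite -uB /amp enum_valK.
  exists B; split.
    (* The right inverse evaluates at the reference configurations and divides by [g]. *)
    apply/row_freeP; exists (\matrix_(i, l) ((enum_val i == Sk l)%:R / g (pos (Sk l)))).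
    apply/matrixP => k l; rewrite !mxE.
    under eq_bigr do rewrite !mxE.
    rewrite (sum_enum_fock (fun S => psi k S * ((S == Sk l)%:R / g (pos (Sk l))))).
    rewrite (bigD1 (Sk l)) //= big1 => [|S /negPf->]; last by rewrite mul0r mulr0.
    have [al _] := Skp l.
    by rewrite eqxx psiSk mul1r addr0 mulfK ?gN0 // eq_sym.
  move=> v; split=> [/expand[c vc]|/submxP[u /comb vu]].
    apply/submxP; exists (\row_k c k); apply/comb => S.
    by rewrite vc; case: ifP => // aS; rewrite mxE inordK ?ordS.
  exact: (gsc (fun k => u 0 (inord k))).
move=> v /expand[c vc]; exact: (symamp_Ssq Ns_le vc).
Qed.

End GroundStates.

Theorem mainTheorem11 (C : numClosedFieldType) (Ns Ne : nat) (t t' : C) :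
  ~~ odd Ns -> odd Ne -> (Ns./2 < Ne)%N -> (Ne < Ns)%N -> 0 < t -> 0 < t' ->
  exists E0 : C,
    [/\ @is_ground_energy C Ns Ne t t' E0,
        @subspace_dim C Ns (@ground_state C Ns Ne t t' E0) Ne.+1 &
        forall v : 'cV[C]_(dimF Ns), @ground_state C Ns Ne t t' E0 v ->
          @Ssq C Ns *m v
            = ((Ne%:R / 2%:R) * (Ne%:R / 2%:R + 1)) *: v].
Proof.
move=> evenN oddNe halfN Ne_lt t_gt0 t'_gt0.
have Ns_gt0 : (0 < Ns)%N by exact: leq_ltn_trans Ne_lt.
by apply: ground_states => //; lia.
Qed.
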